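(* Let $f:\mathbb R\times[a,b]\to\mathbb R$, $(x,t)\mapsto f(x,t)$, be a smooth map defining a smooth curve $t\mapsto f(\cdot,t)$ in $\mathrm{Emb}^+(\mathbb R,\mathbb R)$. Then $f$ is a critical point of the energy $$E(f)=\tfrac12\int_a^b\int_{\mathbb R} f_t^2 f_x\,dx\,dt$$ with respect to all smooth variations with fixed endpoints (that is, $f$ is a geodesic of the metric $G$) if and only if $$f_{tt}=-2\,\frac{f_t f_{tx}}{f_x}.$$ Moreover, if $f$ is a geodesic, then its Eulerian (right trivialized) velocity $u(x,t):=f_t\big(f(\cdot,t)^{-1}(x),t\big)$ satisfies Burgers' equation $$u_t=-3\,u_x u$$ (at all points $x$ in the image of $f(\cdot,t)$).
   Context: $\mathrm{Emb}^+(\mathbb R,\mathbb R)$ is the set of orientation preserving smooth embeddings $\mathbb R\to\mathbb R$ (so $f_x>0$), with tangent space $C^\infty_c(\mathbb R,\mathbb R)$ (smooth functions with compact support) at each point. It carries the weak Riemannian metric $$G_f(h,k)=\int_{\mathbb R}h(x)k(x)\,|f'(x)|\,dx,\qquad h,k\in C_c^\infty(\mathbb R,\mathbb R).$$ A smooth curve in $\mathrm{Emb}^+(\mathbb R,\mathbb R)$ on $[a,b]$ is a smooth $f(x,t)$ with each $f(\cdot,t)\in \mathrm{Emb}^+(\mathbb R,\mathbb R)$ such that $f(x,t)$ is independent of $t$ for $x$ outside some compact set. A smooth variation with fixed endpoints is a smooth $f(x,t,s)$, $s$ near $0$, with $f(x,t,0)=f(x,t)$, each $f(\cdot,t,s)\in\mathrm{Emb}^+(\mathbb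 R,\mathbb R)$, $f(x,t,s)=f(x,t)$ for $x$ outside a compact set, and $f(x,a,s)=f(x,a)$, $f(x,b,s)=f(x,b)$. Critical point means $\frac{\partial}{\partial s}\big|_{0}E(f(\cdot,\cdot,s))=0$ for all such variations. Subscripts denote partial derivatives. *)

(* Defs.v *)
From Stdlib Require Export Reals.
From Coquelicot Require Export Coquelicot.
Open Scope R_scope.

(** Smoothness.  A function on a subset [D] of R^2 or R^3 is smooth if it is
    the restriction of a smooth function defined on an open neighbourhood of
    [D]; values outside [D] are irrelevant. *)

Definition smooth_on2 (D : R * R -> Prop) (f : R -> R -> R) : Prop :=
  exists (U : R * R -> Prop) (F : R -> R -> R),
    open U /\
    (forall x t, D (x, t) -> U (x, t)) /\
    (forall x t, U (x, t) -> forall n, ex_diff_n F n x t) /\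
    (forall x t, D (x, t) -> F x t = f x t).

(** Three-variable analogue of Coquelicot's [ex_diff_n]: at the given point,
    all iterated partial derivatives of order at most [n] exist and are
    continuous. *)
Fixpoint ex_diff3_n (F : R -> R -> R -> R) (n : nat) (x t s : R) : Prop :=
  continuous (fun p : R * R * R => F (fst (fst p)) (snd (fst p)) (snd p))
    (x, t, s) /\
  match n with
  | O => True
  | S n =>
      ex_derive (fun z => F z t s) x /\
      ex_derive (fun z => F x z s) t /\
      ex_derive (fun z => F x t z) s /\
      ex_diff3_n (fun u v w => Derive (fun z => F z v w) u) n x t s /\
      ex_diff3_n (fun u v w => Derive (fun z => F u z w) v) n x t s /\
      ex_diff3_n (fun u v w => Derive (fun z => F u v z) w) n x t s
  end.

Definition smooth_on3 (D : R * R * R -> Prop) (f : R -> R -> R -> R) : Prop :=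
  exists (U : R * R * R -> Prop) (F : R -> R -> R -> R),
    open U /\
    (forall x t s, D (x, t, s) -> U (x, t, s)) /\
    (forall x t s, U (x, t, s) -> forall n, ex_diff3_n F n x t s) /\
    (forall x t s, D (x, t, s) -> F x t s = f x t s).

(** Derivatives relative to a set [D] (one-sided at the endpoints when [D] is a
    closed interval).  [derive_in] is total, and meaningful when
    [ex_derive_in] holds. *)

Definition is_derive_in (D : R -> Prop) (g : R -> R) (t l : R) : Prop :=
  filterlim (fun s => (g s - g t) / (s - t)) (within D (locally' t))
    (locally l).

Definition ex_derive_in (D : R -> Prop) (g : R -> R) (t : R) : Prop :=
  exists l, is_derive_in D g t l.

Definition derive_in (D : R -> Prop) (g : R -> R) (t : R) : R :=
  iota (is_derive_in D g t).

Definition Icc (a b t : R) : Prop := a <= t <= b.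

(** Partial derivatives of a function on R x [a,b]. *)
Definition dx (f : R -> R -> R) (x t : R) : R := Derive (fun y => f y t) x.

Definition dt (a b : R) (f : R -> R -> R) (x t : R) : R :=
  derive_in (Icc a b) (fun r => f x r) t.

(** [inverse g y] is the point mapped to [y] by the injective function [g]; it
    is only meaningful for [y] in the image of [g]. *)
Definition inverse (g : R -> R) (y : R) : R := iota (fun x : R => g x = y).

(** Smooth embeddings: smooth immersions that are homeomorphisms onto their
    image. *)
Definition smooth_embedding (g : R -> R) : Prop :=
  (forall n x, ex_derive_n g n x) /\
  (forall x, Derive g x <> 0) /\
  (forall x y, g x = g y -> x = y) /\
  (forall x, filterlim (inverse g)
     (within (fun y => exists z, y = g z) (locally (g x))) (locally x)).

Definition Emb_plus (g : R -> R) : Prop :=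
  smooth_embedding g /\ forall x, 0 < Derive g x.

Definition smooth_curve (a b : R) (f : R -> R -> R) : Prop :=
  smooth_on2 (fun p => Icc a b (snd p)) f /\
  (forall t, Icc a b t -> Emb_plus (fun x => f x t)) /\
  (exists K : R -> Prop, compact K /\
     forall x t t', ~ K x -> Icc a b t -> Icc a b t' -> f x t = f x t').

Definition smooth_variation (a b : R) (f : R -> R -> R)
    (V : R -> R -> R -> R) : Prop :=
  exists eps : R, 0 < eps /\
    smooth_on3 (fun p => Icc a b (snd (fst p)) /\ Rabs (snd p) < eps) V /\
    (forall x t, Icc a b t -> V x t 0 = f x t) /\
    (forall t s, Icc a b t -> Rabs s < eps -> Emb_plus (fun x => V x t s)) /\
    (exists K : R -> Prop, compact K /\
       forall x t s, ~ K x -> Icc a b t -> Rabs s < eps ->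
         V x t s = f x t) /\
    (forall x s, Rabs s < eps -> V x a s = f x a) /\
    (forall x s, Rabs s < eps -> V x b s = f x b).

Definition integral_R (h : R -> R) : R :=
  RInt_gen h (Rbar_locally m_infty) (Rbar_locally p_infty).

Definition metric_G (g h k : R -> R) : R :=
  integral_R (fun x => h x * k x * Rabs (Derive g x)).

(** The displayed energy, and the energy of a curve for the metric [metric_G]. *)
Definition energy (a b : R) (f : R -> R -> R) : R :=
  / 2 * RInt (fun t => integral_R (fun x => (dt a b f x t) ^ 2 * dx f x t)) a b.

Definition metric_energy (a b : R) (f : R -> R -> R) : R :=
  / 2 * RInt (fun t => metric_G (fun x => f x t)
                         (fun x => dt a b f x t) (fun x => dt a b f x t)) a b.

Definition critical_point (E : (R -> R -> R) -> R) (a b : R)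
    (f : R -> R -> R) : Prop :=
  forall V, smooth_variation a b f V ->
    is_derive (fun s => E (fun x t => V x t s)) 0 0.

Definition geodesic (a b : R) (f : R -> R -> R) : Prop :=
  critical_point (metric_energy a b) a b f.

Definition geodesic_equation (a b : R) (f : R -> R -> R) : Prop :=
  forall x t, Icc a b t ->
    dt a b (dt a b f) x t
      = - 2 * (dt a b f x t * dx (dt a b f) x t / dx f x t).

Definition eulerian_velocity (a b : R) (f : R -> R -> R) (x t : R) : R :=
  dt a b f (inverse (fun y => f y t) x) t.

(** Burgers' equation for [u] on a subset [D] of R x [a,b], including the
    existence of the two partial derivatives. *)
Definition burgers_on (a b : R) (D : R -> R -> Prop) (u : R -> R -> R) : Prop :=
  forall x t, Icc a b t -> D x t ->
    ex_derive (fun y => u y t) x /\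
    ex_derive_in (Icc a b) (fun r => u x r) t /\
    dt a b u x t = - 3 * (dx u x t * u x t).

(* Main.v *)
Require Import Defs.
From Stdlib Require Import Lra Lia Factorial Classical ClassicalEpsilon
  FunctionalExtensionality.

(** Along a variation [V] of [f] with variation field [W = V_s(.,.,0)],
    differentiating the energy under the integral sign and integrating by
    parts in [t] and in [x] gives the first variation formula
    [dE/ds (0) = - int_a^b int W (f_tt f_x + 2 f_t f_tx) dx dt]
    ([first_variation]); the boundary terms vanish because [W] vanishes at
    [t = a], at [t = b] and for large [x].  So the geodesic equation, which says
    that the factor [f_tt f_x + 2 f_t f_tx] is zero, makes [f] critical
    ([defect_critical_point]).  Conversely, if that factor is nonzero at some
    point, it has a constant sign on a small box, and the variation
    [f + s * al(x) * be(t)] with bump functions supported in the box has a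
    nonzero first variation ([critical_point_defect]).  It is a variation
    through embeddings for small [s] because [f_x] is bounded below on compact
    sets ([linear_smooth_variation]).

    The energy of the metric is the displayed energy because [f_x > 0].

    For Burgers' equation, write [u(x,t) = f_t(Y,t)] where [f(Y(x,t),t) = x].
    Implicit differentiation gives [Y_x = 1 / f_x] and [Y_t = - f_t / f_x], so
    [u_x = f_tx / f_x] and [u_t = f_tt - f_tx f_t / f_x], which is
    [- 3 u_x u] by the geodesic equation
    ([burgers_of_geodesic_equation]).

    Two devices recur.  A function that is smooth near the strip
    [R x [a,b]] becomes continuous on the whole plane when its time argument
    is clamped to [[a,b]], so that parametric integrals and Fubini's theorem
    are only needed for globally continuous integrands.  And every derivative
    relative to [[a,b]] is an ordinary derivative of a smooth extension. *)

(** * Continuity of composites *)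

Section Continuity.
Context {T : UniformSpace}.

Lemma continuous_pair {U V : UniformSpace} (u : T -> U) (v : T -> V) (p : T) :
  continuous u p -> continuous v p -> continuous (fun q => (u q, v q)) p.
Proof.
intros Hu Hv.
apply filterlim_locally; intros eps.
pose proof (proj1 (filterlim_locally u (u p)) Hu eps) as H1.
pose proof (proj1 (filterlim_locally v (v p)) Hv eps) as H2.
generalize (filter_and _ _ H1 H2).
apply filter_imp; intros q [A B]; split; assumption.
Qed.

Lemma continuous_Rmult (u v : T -> R) (p : T) :
  continuous u p -> continuous v p -> continuous (fun q => u q * v q) p.
Proof. exact (@continuous_mult T R_AbsRing u v p). Qed.

Lemma continuous_Rplus (u v : T -> R) (p : T) :
  continuous u p -> continuous v p -> continuous (fun q => u q + v q) p.
Proof. exact (@continuous_plus T R_AbsRing R_NormedModule u v p). Qed.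

Lemma continuous_app2 (h : R -> R -> R) (u v : T -> R) (p : T) :
  continuous (fun q : R * R => h (fst q) (snd q)) (u p, v p) ->
  continuous u p -> continuous v p ->
  continuous (fun q => h (u q) (v q)) p.
Proof.
intros Hh Hu Hv.
exact (continuous_comp_2 u v h p Hu Hv Hh).
Qed.

Lemma continuous_app3 (h : R -> R -> R -> R) (u v w : T -> R) (p : T) :
  continuous (fun q : R * R * R => h (fst (fst q)) (snd (fst q)) (snd q))
    (u p, v p, w p) ->
  continuous u p -> continuous v p -> continuous w p ->
  continuous (fun q => h (u q) (v q) (w q)) p.
Proof.
intros Hh Hu Hv Hw.
exact (continuous_comp_2 (fun q => (u q, v q)) w
  (fun (z : R * R) (y : R) => h (fst z) (snd z) y) p
  (continuous_pair u v p Hu Hv) Hw Hh).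
Qed.

End Continuity.

Definition cont2 (h : R -> R -> R) : Prop :=
  forall p, continuous (fun q : R * R => h (fst q) (snd q)) p.

Definition cont3 (h : R -> R -> R -> R) : Prop :=
  forall p, continuous
    (fun q : R * R * R => h (fst (fst q)) (snd (fst q)) (snd q)) p.

Lemma cont2_app {T : UniformSpace} (h : R -> R -> R) (u v : T -> R) (p : T) :
  cont2 h -> continuous u p -> continuous v p ->
  continuous (fun q => h (u q) (v q)) p.
Proof. intros Hh; apply continuous_app2; apply Hh. Qed.

Lemma cont3_app {T : UniformSpace} (h : R -> R -> R -> R) (u v w : T -> R)
    (p : T) :
  cont3 h -> continuous u p -> continuous v p -> continuous w p ->
  continuous (fun q => h (u q) (v q) (w q)) p.
Proof. intros Hh; apply continuous_app3; apply Hh. Qed.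

Lemma continuous_fst' {U V : UniformSpace} (p : U * V) : continuous fst p.
Proof. destruct p; apply continuous_fst. Qed.

Lemma continuous_snd' {U V : UniformSpace} (p : U * V) : continuous snd p.
Proof. destruct p; apply continuous_snd. Qed.

Lemma continuous_comp_fst {T U V : UniformSpace} (u : T -> U * V) (p : T) :
  continuous u p -> continuous (fun q => fst (u q)) p.
Proof. intros Hu; apply (continuous_comp u fst p Hu), continuous_fst'. Qed.

Lemma continuous_comp_snd {T U V : UniformSpace} (u : T -> U * V) (p : T) :
  continuous u p -> continuous (fun q => snd (u q)) p.
Proof. intros Hu; apply (continuous_comp u snd p Hu), continuous_snd'. Qed.

Ltac cont_tac :=
  repeat first
    [ assumption
    | lazymatch goal with
      | |- continuous (fun _ => ?c) _ => apply continuous_const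
      | |- continuous (fun q => q) _ => apply continuous_id
      | |- continuous fst _ => apply continuous_fst'
      | |- continuous snd _ => apply continuous_snd'
      | |- continuous (fun q => fst (@?u q)) _ => apply (continuous_comp_fst u)
      | |- continuous (fun q => snd (@?u q)) _ => apply (continuous_comp_snd u)
      | |- continuous (fun q => @?u q * @?v q) _ =>
          apply (continuous_Rmult u v)
      | |- continuous (fun q => @?u q + @?v q) _ =>
          apply (continuous_Rplus u v)
      | H : cont3 ?h |- continuous (fun q => ?h (@?u q) (@?v q) (@?w q)) _ =>
          apply (cont3_app h u v w _ H)
      | H : cont2 ?h |- continuous (fun q => ?h (@?u q) (@?v q)) _ =>
          apply (cont2_app h u v _ H)
      end ].

(** * Iterated integrals of continuous functions *)

Lemma ex_RInt_cont (g : R -> R) (c d : R) :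
  (forall x, continuous g x) -> ex_RInt g c d.
Proof. intros Hg; apply (ex_RInt_continuous g); intros; apply Hg. Qed.

Lemma is_derive_RInt_cont (g : R -> R) (a z : R) :
  (forall x, continuous g x) -> is_derive (fun z => RInt g a z) z (g z).
Proof.
intros Hg; apply (is_derive_RInt g (fun z => RInt g a z) a); [|apply Hg].
apply filter_forall; intros w.
apply (@RInt_correct R_CompleteNormedModule), ex_RInt_cont, Hg.
Qed.

(** Lebesgue number argument: finitely many of the neighbourhoods cover
    [[c,d]]. *)
Lemma compact_uniform {T : UniformSpace} (c d : R) (p0 : T)
    (Q : R -> T -> Prop) :
  (forall x, exists delta : posreal, forall y p,
     Rabs (y - x) < delta -> ball p0 delta p -> Q y p) ->
  exists delta : posreal, forall y p, c <= y <= d -> ball p0 delta p -> Q y p.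
Proof.
intros H.
pose (D := fun x => proj1_sig (constructive_indefinite_description _ (H x))).
assert (HD : forall x y p, Rabs (y - x) < D x -> ball p0 (D x) p -> Q y p)
  by (intros x; exact (proj2_sig (constructive_indefinite_description _ (H x)))).
destruct (compactness_value_1d c d D) as [delta Hdelta].
exists delta; intros y p Hy Hp.
destruct (NNPP _ (Hdelta y Hy)) as [x [_ [Hx Hle]]].
apply (HD x); [assumption | apply ball_le with delta; assumption].
Qed.

Lemma continuous_RInt_param {T : UniformSpace} (h : R -> T -> R) (c d : R) :
  (forall q, continuous (fun q : R * T => h (fst q) (snd q)) q) ->
  forall p, continuous (fun p => RInt (fun x => h x p) c d) p.
Proof.
assert (Hle : forall c d : R, c <= d -> (forall q,
  continuous (fun q : R * T => h (fst q) (snd q)) q) ->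
  forall p, continuous (fun p => RInt (fun x => h x p) c d) p).
2:{ intros Hh p; destruct (Rle_dec c d) as [Hcd|Hcd].
    - apply Hle; assumption.
    - apply continuous_ext with (fun p => (-1) * RInt (fun x => h x p) d c).
      + intros q; rewrite <- (opp_RInt_swap (fun x => h x q) d c).
        * unfold opp; simpl; ring.
        * apply ex_RInt_cont; intros x.
          apply (continuous_comp (fun x => (x, q)) (fun q : R * T => h (fst q)
            (snd q))); [|apply Hh].
          apply continuous_pair; [apply continuous_id | apply continuous_const].
      + apply continuous_Rmult; [apply continuous_const | apply Hle;
          [lra|assumption]]. }
clear c d; intros c d Hcd Hh p0.
assert (Hx : forall p x, continuous (fun x => h x p) x).
{ intros p x.
  apply (continuous_comp (fun x => (x, p)) (fun q : R * T => h (fst q) (snd q)));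
    [|apply Hh].
  apply continuous_pair; [apply continuous_id | apply continuous_const]. }
apply filterlim_locally; intros eps.
assert (He : 0 < eps / (2 * (d - c + 1))).
{ apply Rdiv_lt_0_compat; [apply eps | lra]. }
destruct (compact_uniform c d p0
  (fun y p => Rabs (h y p - h y p0) <= eps / (2 * (d - c + 1)))) as [delta Hdelta].
- intros x.
  assert (He2 : 0 < eps / (2 * (d - c + 1)) / 2) by lra.
  destruct (proj1 (filterlim_locally _ _) (Hh (x, p0)) (mkposreal _ He2))
    as [del Hdel].
  exists del; intros y p Hy Hp.
  assert (A : Rabs (h y p - h x p0) < eps / (2 * (d - c + 1)) / 2).
  { apply (Hdel (y, p)); split; [exact Hy | exact Hp]. }
  assert (B : Rabs (h y p0 - h x p0) < eps / (2 * (d - c + 1)) / 2).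
  { apply (Hdel (y, p0)); split; [exact Hy | apply ball_center]. }
  apply Rabs_def2 in A; apply Rabs_def2 in B; apply Rabs_le; lra.
- exists delta; intros p Hp.
  change (Rabs (RInt (fun x => h x p) c d - RInt (fun x => h x p0) c d) < eps).
  rewrite <- (RInt_minus (fun x => h x p) (fun x => h x p0));
    try (apply ex_RInt_cont; apply Hx).
  apply Rle_lt_trans with ((d - c) * (eps / (2 * (d - c + 1)))).
  + apply abs_RInt_le_const; [assumption | |].
    * apply (ex_RInt_minus (fun x => h x p) (fun x => h x p0));
        apply ex_RInt_cont; apply Hx.
    * intros x Hxx; apply (Hdelta x p); assumption.
  + replace (pos eps) with ((d - c + (d - c + 2)) * (eps / (2 * (d - c + 1))))
      at 2 by (field; lra).
    apply Rmult_lt_compat_r; lra.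
Qed.

Lemma RInt_empty (g : R -> R) (a : R) : RInt g a a = 0.
Proof. exact (RInt_point a g). Qed.

Lemma RInt_zero (a b : R) : RInt (fun _ => 0) a b = 0.
Proof. rewrite RInt_const; apply Rmult_0_r. Qed.

Lemma RInt_eq_zero (g : R -> R) (a b : R) :
  a <= b -> (forall x, a <= x <= b -> g x = 0) -> RInt g a b = 0.
Proof.
intros Hab Hg; rewrite <- (RInt_zero a b); apply RInt_ext.
rewrite Rmin_left, Rmax_right by assumption; intros x Hx; apply Hg; lra.
Qed.

Lemma fubini (h : R -> R -> R) (a b c d : R) :
  cont2 h -> a <= b ->
  RInt (fun y => RInt (fun x => h x y) c d) a b
  = RInt (fun x => RInt (fun y => h x y) a b) c d.
Proof.
intros Hh Hab.
destruct (Rle_lt_or_eq_dec a b Hab) as [Hlt|<-].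
2:{ rewrite RInt_empty, (RInt_ext _ (fun _ => 0)).
    - symmetry; apply RInt_zero.
    - intros x _; apply RInt_empty. }
set (Phi := fun z => RInt (fun y => RInt (fun x => h x y) c d) a z
                   - RInt (fun x => RInt (fun y => h x y) a z) c d).
assert (Hin : forall y, continuous (fun y => RInt (fun x => h x y) c d) y).
{ apply (continuous_RInt_param (fun x y => h x y)); intros q; cont_tac. }
assert (Hxy : forall x y, continuous (fun y => h x y) y) by (intros; cont_tac).
assert (Hd : forall x z, is_derive (fun z => RInt (fun y => h x y) a z) z (h x z)).
{ intros x z; apply is_derive_RInt_cont, Hxy. }
assert (H0 : Phi a = Phi b).
{ apply (@eq_is_derive R_NormedModule Phi a b); [|assumption].
  intros z _.
  assert (D : is_derive Phi z
    (RInt (fun x => h x z) c d - RInt (fun x => h x z) c d));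
    [|rewrite Rminus_diag in D; exact D].
  apply @is_derive_minus.
  - apply (is_derive_RInt_cont (fun y => RInt (fun x => h x y) c d)), Hin.
  - replace (RInt (fun x => h x z) c d)
      with (RInt (fun x => Derive (fun u => RInt (fun y => h x y) a u) z) c d).
    + apply (is_derive_RInt_param (fun z x => RInt (fun y => h x y) a z)).
      * apply filter_forall; intros w x _; eexists; apply Hd.
      * intros x _; apply continuity_2d_pt_ext with (fun u v => h v u).
        { intros u v; symmetry; apply is_derive_unique, Hd. }
        apply continuity_2d_pt_filterlim.
        change (continuous (fun q : R * R => h (snd q) (fst q)) (z, x)); cont_tac.
      * apply filter_forall; intros w; apply ex_RInt_cont.
        apply (continuous_RInt_param (fun y x => h x y)); intros q; cont_tac.
    + apply RInt_ext; intros x _; apply is_derive_unique, Hd. }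
unfold Phi in H0; rewrite RInt_empty in H0.
rewrite (RInt_ext (fun x => RInt (fun y => h x y) a a) (fun _ => 0)) in H0
  by (intros x _; apply RInt_empty).
rewrite RInt_zero in H0; lra.
Qed.

(** [H0] and [G] stand for the integrand at [s = 0] and its [s]-derivative.
    Two applications of Fubini's theorem turn the triple integral of [G] into
    [int_0^s (int int G)], and the fundamental theorem of calculus
    differentiates it. *)
Lemma is_derive_double_RInt (H0 : R -> R -> R) (G : R -> R -> R -> R)
    (E : R -> R) (a b c d e : R) :
  a <= b -> c <= d -> 0 < e -> cont2 H0 -> cont3 G ->
  (forall s, Rabs s < e ->
     E s = RInt (fun t => RInt (fun x =>
             H0 x t + RInt (fun r => G x t r) 0 s) c d) a b) ->
  is_derive E 0 (RInt (fun t => RInt (fun x => G x t 0) c d) a b).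
Proof.
intros Hab Hcd He CH CG HE.
set (J := fun t r => RInt (fun x => G x t r) c d).
set (L := fun r => RInt (fun t => J t r) a b).
assert (CJ : cont2 J).
{ intros p.
  apply (continuous_RInt_param (fun x (p : R * R) => G x (fst p) (snd p))).
  intros q; cont_tac. }
assert (CL : forall r, continuous L r).
{ apply (continuous_RInt_param J); intros q; cont_tac. }
assert (CI : cont3 (fun x t s => RInt (fun r => G x t r) 0 s)).
{ (* the substitution r = s * w turns the moving endpoint into a parameter *)
  intros p.
  apply continuous_ext with (fun p : R * R * R =>
    snd p * RInt (fun w => G (fst (fst p)) (snd (fst p)) (snd p * w)) 0 1).
  - intros [[x t] s]; simpl.
    transitivity (RInt (fun w => s * G x t (s * w)) 0 1).
    + symmetry; apply (RInt_scal (fun w => G x t (s * w))).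
      apply ex_RInt_cont; intros w; cont_tac.
    + rewrite (RInt_ext _ (fun w => scal s (G x t (s * w + 0)))).
      * rewrite (RInt_comp_lin (fun r => G x t r)).
        { f_equal; ring. }
        apply ex_RInt_cont; intros w; cont_tac.
      * intros w _; rewrite Rplus_0_r; reflexivity.
  - apply continuous_Rmult; [cont_tac|].
    apply (continuous_RInt_param (fun w (p : R * R * R) =>
      G (fst (fst p)) (snd (fst p)) (snd p * w))); intros q; cont_tac. }
apply is_derive_ext_loc with (fun s =>
  RInt (fun t => RInt (fun x => H0 x t) c d) a b + RInt L 0 s).
- exists (mkposreal e He); intros s Hs.
  assert (Hs' : Rabs s < e)
    by (change (Rabs (s - 0) < e) in Hs; rewrite Rminus_0_r in Hs; exact Hs).
  rewrite (HE s Hs'); symmetry.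
  transitivity (RInt (fun t => RInt (fun x => H0 x t) c d + RInt (fun r => J t r)
    0 s) a b).
  + apply RInt_ext; intros t _.
    etransitivity.
    * apply (RInt_plus (fun x => H0 x t) (fun x => RInt (fun r => G x t r) 0 s)).
      { apply ex_RInt_cont; intros; cont_tac. }
      { apply ex_RInt_cont; intros x.
        apply (cont3_app (fun x t s => RInt (fun r => G x t r) 0 s)); cont_tac. }
    * unfold plus; simpl; f_equal.
      unfold J; apply (fubini (fun r x => G x t r)); [|assumption].
      intros q; cont_tac.
  + etransitivity.
    * apply (RInt_plus (fun t => RInt (fun x => H0 x t) c d)
        (fun t => RInt (fun r => J t r) 0 s)).
      { apply ex_RInt_cont; apply (continuous_RInt_param H0); exact CH. }
      { apply ex_RInt_cont; intros x.
        apply (continuous_RInt_param (fun r t => J t r)); intros q; cont_tac. }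
    * unfold plus; simpl; f_equal.
      unfold L; apply (fubini (fun r t => J t r)); [|assumption].
      intros q; cont_tac.
- replace (RInt (fun t => RInt (fun x => G x t 0) c d) a b) with (0 + L 0)
    by apply Rplus_0_l.
  apply @is_derive_plus; [apply @is_derive_const|].
  apply is_derive_RInt_cont, CL.
Qed.

Lemma RInt_pos_of_bump (h : R -> R) (c d p q : R) :
  c <= p -> p < q -> q <= d -> (forall x, continuous h x) ->
  (forall x, p < x < q -> 0 < h x) ->
  (forall x, ~ p < x < q -> h x = 0) ->
  0 < RInt h c d.
Proof.
intros Hcp Hpq Hqd Ch Hpos H0.
assert (Hex : forall u v, ex_RInt h u v) by (intros; apply ex_RInt_cont, Ch).
rewrite <- (RInt_Chasles h c p d), <- (RInt_Chasles h p q d) by apply Hex.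
rewrite (RInt_eq_zero h c p), (RInt_eq_zero h q d); try assumption;
  try (intros x Hx; apply H0; lra).
unfold plus; simpl.
generalize (RInt_gt_0 h p q Hpq Hpos (fun x _ => Ch x)); lra.
Qed.

(** * Integrals over a strip *)

(** The nearest point of [[a,b]]. *)
Definition clamp (a b t : R) : R := Rmax a (Rmin b t).

Lemma clamp_in (a b t : R) : a <= b -> a <= clamp a b t <= b.
Proof.
intros Hab; unfold clamp; split; [apply Rmax_l|].
apply Rmax_lub; [assumption | apply Rmin_l].
Qed.

Lemma clamp_id (a b t : R) : a <= t <= b -> clamp a b t = t.
Proof. intros H; unfold clamp; rewrite Rmin_right, Rmax_right; lra. Qed.

Lemma continuous_clamp (a b t : R) : continuous (clamp a b) t.
Proof.
apply filterlim_locally; intros eps; exists eps; intros s Hs.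
change (Rabs (s - t) < eps) in Hs.
change (Rabs (clamp a b s - clamp a b t) < eps).
apply Rle_lt_trans with (Rabs (s - t)); [|assumption].
unfold clamp, Rmax, Rmin, Rabs.
repeat (destruct (Rle_dec _ _) || destruct (Rcase_abs _)); lra.
Qed.

Definition cont_strip (a b : R) (h : R -> R -> R) : Prop :=
  forall x t, a <= t <= b ->
    continuous (fun q : R * R => h (fst q) (snd q)) (x, t).

(** Clamping the time makes a function that is continuous at the points of the
    strip [R x [a,b]] continuous on the whole plane. *)
Lemma cont_strip_clamp a b h : a <= b -> cont_strip a b h ->
  cont2 (fun x t => h x (clamp a b t)).
Proof.
intros Hab Hh [x t]; apply (continuous_app2 h).
- apply Hh, clamp_in, Hab.
- cont_tac.
- apply (continuous_comp snd (clamp a b)); [cont_tac | apply continuous_clamp].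
Qed.

Lemma cont_strip_x a b h t x : cont_strip a b h -> a <= t <= b ->
  continuous (fun x => h x t) x.
Proof.
intros Hh Ht; apply (continuous_app2 h (fun x => x) (fun _ => t));
  [apply Hh, Ht | cont_tac | cont_tac].
Qed.

Lemma double_RInt_ext (h k : R -> R -> R) (a b c d : R) :
  a <= b -> (forall x t, a <= t <= b -> h x t = k x t) ->
  RInt (fun t => RInt (fun x => h x t) c d) a b
  = RInt (fun t => RInt (fun x => k x t) c d) a b.
Proof.
intros Hab H; apply RInt_ext; rewrite Rmin_left, Rmax_right by assumption.
intros t Ht; apply RInt_ext; intros x _; apply H; lra.
Qed.

Lemma double_RInt_plus (h k : R -> R -> R) (a b c d : R) :
  a <= b -> cont_strip a b h -> cont_strip a b k ->
  RInt (fun t => RInt (fun x => h x t + k x t) c d) a b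
  = RInt (fun t => RInt (fun x => h x t) c d) a b
    + RInt (fun t => RInt (fun x => k x t) c d) a b.
Proof.
intros Hab Hh Hk.
assert (Ex : forall g, cont_strip a b g -> ex_RInt (fun t => RInt (fun x => g x t)
  c d) a b).
{ intros g Hg; apply ex_RInt_ext with (fun t => RInt (fun x => g x (clamp a b t))
    c d).
  - rewrite Rmin_left, Rmax_right by assumption; intros t Ht.
    rewrite clamp_id; [reflexivity | lra].
  - apply ex_RInt_cont, (continuous_RInt_param (fun x t => g x (clamp a b t))).
    apply (cont_strip_clamp a b g Hab Hg). }
etransitivity; [|apply (RInt_plus _ _ a b (Ex h Hh) (Ex k Hk))].
apply RInt_ext; rewrite Rmin_left, Rmax_right by assumption; intros t Ht.
apply (RInt_plus (fun x => h x t) (fun x => k x t)); apply ex_RInt_cont; intros x.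
- apply (cont_strip_x a b h); [assumption | lra].
- apply (cont_strip_x a b k); [assumption | lra].
Qed.

(** Each half integrates to zero by the fundamental theorem of calculus, after
    exchanging the order of integration for [Pt]. *)
Lemma divergence_zero (P Q Pt Qx : R -> R -> R) (a b c d : R) :
  a <= b -> c <= d ->
  (forall x t, a <= t <= b -> is_derive (fun t => P x t) t (Pt x t)) ->
  (forall x t, a <= t <= b -> is_derive (fun x => Q x t) x (Qx x t)) ->
  (forall x t, a <= t <= b ->
     continuous (fun q : R * R => Pt (fst q) (snd q)) (x, t)) ->
  (forall x t, a <= t <= b ->
     continuous (fun q : R * R => Qx (fst q) (snd q)) (x, t)) ->
  (forall x, P x a = 0) -> (forall x, P x b = 0) ->
  (forall t, a <= t <= b -> Q c t = 0) ->
  (forall t, a <= t <= b -> Q d t = 0) ->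
  RInt (fun t => RInt (fun x => Pt x t + Qx x t) c d) a b = 0.
Proof.
intros Hab Hcd DP DQ CP CQ Pa Pb Qc Qd.
assert (CPc : cont2 (fun x t => Pt x (clamp a b t))).
{ intros [x t]; apply (continuous_app2 Pt).
  - apply CP, clamp_in, Hab.
  - cont_tac.
  - apply (continuous_comp snd (clamp a b)); [cont_tac | apply continuous_clamp]. }
transitivity (RInt (fun t => RInt (fun x => Pt x (clamp a b t)) c d) a b).
- apply RInt_ext; rewrite Rmin_left, Rmax_right by assumption.
  intros t Ht; assert (Ht' : a <= t <= b) by lra.
  rewrite (clamp_id a b t Ht').
  etransitivity.
  + apply (RInt_plus (fun x => Pt x t) (fun x => Qx x t)); apply ex_RInt_cont;
      intros x.
    * apply (continuous_app2 Pt (fun x => x) (fun _ => t)); [apply CP, Ht' |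
        cont_tac | cont_tac].
    * apply (continuous_app2 Qx (fun x => x) (fun _ => t)); [apply CQ, Ht' |
        cont_tac | cont_tac].
  + replace (RInt (fun x => Qx x t) c d) with (Q d t - Q c t).
    * rewrite Qc, Qd by assumption; unfold plus; simpl; ring.
    * symmetry; apply is_RInt_unique.
      apply (is_RInt_derive (fun x => Q x t) (fun x => Qx x t)).
      { intros; apply DQ, Ht'. }
      { intros x _; apply (continuous_app2 Qx (fun x => x) (fun _ => t)); [apply CQ,
          Ht' | cont_tac | cont_tac]. }
- rewrite (fubini (fun x t => Pt x (clamp a b t))) by assumption.
  apply RInt_eq_zero; [assumption|]; intros x _.
  transitivity (RInt (fun t => Pt x t) a b).
  + apply RInt_ext; rewrite Rmin_left, Rmax_right by assumption.
    intros t Ht; rewrite clamp_id; [reflexivity | lra].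
  + replace 0 with (P x b - P x a) by (rewrite Pa, Pb; ring).
    apply is_RInt_unique.
    apply (is_RInt_derive (fun t => P x t) (fun t => Pt x t));
      rewrite Rmin_left, Rmax_right by assumption; intros t Ht.
    * apply DP, Ht.
    * apply (continuous_app2 Pt (fun _ => x) (fun t => t)); [apply CP, Ht |
        cont_tac | cont_tac].
Qed.

(** * Derivatives as limits of quotients *)

Lemma is_derive_Rmult (g h : R -> R) (x dg dh : R) :
  is_derive g x dg -> is_derive h x dh ->
  is_derive (fun y => g y * h y) x (dg * h x + g x * dh).
Proof. intros Hg Hh; exact (is_derive_mult g h x dg dh Hg Hh Rmult_comm). Qed.

Lemma is_derive_eq (g : R -> R) (x l l' : R) :
  is_derive g x l -> l = l' -> is_derive g x l'.
Proof. intros H <-; exact H. Qed.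

Lemma is_derive_quotient (g : R -> R) (t l : R) :
  is_derive g t l ->
  filterlim (fun s => (g s - g t) / (s - t)) (locally' t) (locally l).
Proof.
intros H; apply is_derive_Reals in H.
apply filterlim_locally; intros eps.
destruct (H eps (cond_pos eps)) as [delta Hd].
exists delta; intros s Hs Hne.
change (Rabs ((g s - g t) / (s - t) - l) < eps).
change (Rabs (s - t) < delta) in Hs.
generalize (Hd (s - t) ltac:(lra) Hs).
rewrite Rplus_minus; trivial.
Qed.

Lemma quotient_is_derive (g : R -> R) (t l : R) :
  filterlim (fun s => (g s - g t) / (s - t)) (locally' t) (locally l) ->
  is_derive g t l.
Proof.
intros H; apply is_derive_Reals; intros eps He.
destruct (proj1 (filterlim_locally _ _) H (mkposreal eps He)) as [delta Hd].
exists delta; intros h Hh Hlt.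
assert (B : ball t delta (t + h)).
{ change (Rabs (t + h - t) < delta); replace (t + h - t) with h by ring; exact Hlt. }
generalize (Hd (t + h) B ltac:(lra)).
change (Rabs ((g (t + h) - g t) / (t + h - t) - l) < eps -> Rabs ((g (t + h) - g t)
  / h - l) < eps).
replace (t + h - t) with h by ring; trivial.
Qed.

Lemma Icc_proper (a b t : R) :
  a < b -> Icc a b t -> ProperFilter (within (Icc a b) (locally' t)).
Proof.
intros Hab [Ha Hb]; split.
- intros P [delta HP].
  assert (Hd := cond_pos delta).
  destruct (Rlt_dec t b) as [Htb|Htb].
  + set (h := Rmin (delta / 2) (b - t)).
    assert (h <= delta / 2 /\ h <= b - t /\ 0 < h).
    { repeat split; [apply Rmin_l | apply Rmin_r | apply Rmin_glb_lt; lra]. }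
    exists (t + h); apply HP; unfold Icc; try lra.
    change (Rabs (t + h - t) < delta); rewrite Rabs_pos_eq; lra.
  + set (h := Rmin (delta / 2) (t - a)).
    assert (h <= delta / 2 /\ h <= t - a /\ 0 < h).
    { repeat split; [apply Rmin_l | apply Rmin_r | apply Rmin_glb_lt; lra]. }
    exists (t - h); apply HP; unfold Icc; try lra.
    change (Rabs (t - h - t) < delta); rewrite Rabs_left; lra.
- repeat apply within_filter; apply locally_filter.
Qed.

Lemma is_derive_in_unique (a b : R) (g : R -> R) (t l : R) :
  a < b -> Icc a b t -> is_derive_in (Icc a b) g t l ->
  derive_in (Icc a b) g t = l.
Proof.
intros Hab Ht H.
assert (PF := Icc_proper a b t Hab Ht).
apply (@iota_unique R_AbsRing R_CompleteNormedModule); [|exact H].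
intros l' H'.
apply (@filterlim_locally_unique R R_AbsRing R_NormedModule
  (within (Icc a b) (locally' t)) _ _ _ _ H' H).
Qed.

(** Restricting the quotient to [[a,b]] keeps its limit, which computes one-sided
    derivatives from any differentiable extension. *)
Lemma is_derive_in_of_is_derive (a b : R) (g G : R -> R) (t l : R) :
  Icc a b t -> (forall s, Icc a b s -> G s = g s) ->
  is_derive G t l -> is_derive_in (Icc a b) g t l.
Proof.
intros Ht Hg H; unfold is_derive_in.
apply filterlim_within_ext with (fun s => (G s - G t) / (s - t)).
- intros s Hs; rewrite !Hg by assumption; reflexivity.
- eapply filterlim_filter_le_1; [|apply is_derive_quotient, H].
  intros P; unfold within; apply filter_imp; auto.
Qed.

Lemma derive_in_of_is_derive (a b : R) (g G : R -> R) (t : R) :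
  a < b -> Icc a b t -> (forall s, Icc a b s -> G s = g s) ->
  ex_derive G t -> derive_in (Icc a b) g t = Derive G t.
Proof.
intros Hab Ht Hg H; apply is_derive_in_unique; try assumption.
apply is_derive_in_of_is_derive with G; try assumption.
apply Derive_correct, H.
Qed.

(** * Smooth functions of one, two and three variables *)

Definition smooth1 (g : R -> R) : Prop := forall n x, ex_derive_n g n x.

Lemma ex_derive_n_Derive g n x :
  ex_derive_n g (S (S n)) x -> ex_derive_n (Derive g) (S n) x.
Proof.
simpl; intros H; apply ex_derive_ext with (2 := H); intros y.
change (Derive_n g (S n) y = Derive_n (Derive_n g 1) n y).
rewrite Derive_n_comp; f_equal; lia.
Qed.

Lemma smooth1_Derive g : smooth1 g -> smooth1 (Derive g).
Proof.
intros Hg [|n] x; [exact I | apply ex_derive_n_Derive, Hg].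
Qed.

Lemma smooth1_ex g x : smooth1 g -> ex_derive g x.
Proof. intros Hg; apply (Hg 1%nat). Qed.

Lemma smooth1_cont g x : smooth1 g -> continuous g x.
Proof. intros Hg; apply @ex_derive_continuous, smooth1_ex, Hg. Qed.

Lemma smooth1_id : smooth1 (fun s => s).
Proof.
intros n x; destruct n as [|[|n]]; [exact I | apply @ex_derive_id |].
simpl; apply ex_derive_ext with (fun _ => Derive_n (fun _ => 1) n x).
- intros y. change (Derive_n (fun _ => 1) n x = Derive_n (fun s => s) (S n) y).
  replace (S n) with (n + 1)%nat by lia; rewrite <- Derive_n_comp.
  replace (Derive_n (fun s => s) 1) with (fun _ : R => 1).
  + destruct n as [|n]; [reflexivity | rewrite !Derive_n_const; reflexivity].
  + apply functional_extensionality; intros z; symmetry; apply Derive_id.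
- apply @ex_derive_const.
Qed.

Definition dy (F : R -> R -> R) (u v : R) : R := Derive (fun z => F u z) v.

Definition smooth2 (U : R * R -> Prop) (F : R -> R -> R) : Prop :=
  forall x t, U (x, t) -> forall n, ex_diff_n F n x t.

Lemma smooth2_cont U F x t : smooth2 U F -> U (x, t) ->
  continuous (fun q : R * R => F (fst q) (snd q)) (x, t).
Proof.
intros HF HU; apply continuity_2d_pt_filterlim, (HF x t HU 0%nat).
Qed.

Lemma smooth2_ex_dx U F x t : smooth2 U F -> U (x, t) ->
  ex_derive (fun z => F z t) x.
Proof. intros HF HU; apply (HF x t HU 1%nat). Qed.

Lemma smooth2_ex_dy U F x t : smooth2 U F -> U (x, t) ->
  ex_derive (fun z => F x z) t.
Proof. intros HF HU; apply (HF x t HU 1%nat). Qed.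

Lemma smooth2_dx U F : smooth2 U F -> smooth2 U (dx F).
Proof. intros HF x t HU n; apply (HF x t HU (S n)). Qed.

Lemma smooth2_dy U F : smooth2 U F -> smooth2 U (dy F).
Proof. intros HF x t HU n; apply (HF x t HU (S n)). Qed.

Definition D1 (F : R -> R -> R -> R) (u v w : R) : R :=
  Derive (fun z => F z v w) u.
Definition D2 (F : R -> R -> R -> R) (u v w : R) : R :=
  Derive (fun z => F u z w) v.
Definition D3 (F : R -> R -> R -> R) (u v w : R) : R :=
  Derive (fun z => F u v z) w.

Definition smooth3 (U : R * R * R -> Prop) (F : R -> R -> R -> R) : Prop :=
  forall x t s, U (x, t, s) -> forall n, ex_diff3_n F n x t s.

Section Smooth3.
Context (U : R * R * R -> Prop) (HO : open U).

Lemma smooth3_cont F p : smooth3 U F -> U p ->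
  continuous (fun q : R * R * R => F (fst (fst q)) (snd (fst q)) (snd q)) p.
Proof. destruct p as [[x t] s]; intros HF HU; apply (HF x t s HU 0%nat). Qed.

Lemma smooth3_is_D1 F x t s : smooth3 U F -> U (x, t, s) ->
  is_derive (fun z => F z t s) x (D1 F x t s).
Proof. intros HF HU; apply Derive_correct, (HF x t s HU 1%nat). Qed.

Lemma smooth3_is_D2 F x t s : smooth3 U F -> U (x, t, s) ->
  is_derive (fun z => F x z s) t (D2 F x t s).
Proof. intros HF HU; apply Derive_correct, (HF x t s HU 1%nat). Qed.

Lemma smooth3_is_D3 F x t s : smooth3 U F -> U (x, t, s) ->
  is_derive (fun z => F x t z) s (D3 F x t s).
Proof. intros HF HU; apply Derive_correct, (HF x t s HU 1%nat). Qed.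

Lemma smooth3_D1 F : smooth3 U F -> smooth3 U (D1 F).
Proof. intros HF x t s HU n; apply (HF x t s HU (S n)). Qed.

Lemma smooth3_D2 F : smooth3 U F -> smooth3 U (D2 F).
Proof. intros HF x t s HU n; apply (HF x t s HU (S n)). Qed.

Lemma smooth3_D3 F : smooth3 U F -> smooth3 U (D3 F).
Proof. intros HF x t s HU n; apply (HF x t s HU (S n)). Qed.

Lemma open3_box x t s : U (x, t, s) ->
  exists delta : posreal, forall u v w, Rabs (u - x) < delta ->
    Rabs (v - t) < delta -> Rabs (w - s) < delta -> U (u, v, w).
Proof.
intros HU; destruct (HO _ HU) as [delta Hd].
exists delta; intros u v w Hu Hv Hw; apply Hd; repeat split; assumption.
Qed.

Lemma smooth3_cont_2d F (u v w : R -> R -> R) x t :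
  smooth3 U F -> U (u x t, v x t, w x t) ->
  continuous (fun q : R * R => u (fst q) (snd q)) (x, t) ->
  continuous (fun q : R * R => v (fst q) (snd q)) (x, t) ->
  continuous (fun q : R * R => w (fst q) (snd q)) (x, t) ->
  continuity_2d_pt (fun x t => F (u x t) (v x t) (w x t)) x t.
Proof.
intros HF HU Hu Hv Hw; apply continuity_2d_pt_filterlim.
apply (continuous_app3 F (fun q => u (fst q) (snd q)) (fun q => v (fst q) (snd q))
  (fun q => w (fst q) (snd q)));
  try assumption.
apply smooth3_cont; assumption.
Qed.

Lemma Rabs_diag_lt (x : R) (d : posreal) : Rabs (x - x) < d.
Proof. rewrite Rminus_diag, Rabs_R0; apply cond_pos. Qed.

Lemma schwarz12 F x t s : smooth3 U F -> U (x, t, s) ->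
  D1 (D2 F) x t s = D2 (D1 F) x t s.
Proof.
intros HF HU; apply (Schwarz (fun x t => F x t s) x t).
- destruct (open3_box x t s HU) as [delta Hd]; exists delta; intros u v Hu Hv.
  assert (HUv : U (u, v, s)) by (apply Hd; try assumption; apply Rabs_diag_lt).
  pose proof (HF _ _ _ HUv 2%nat) as H2; simpl in H2; tauto.
- apply (smooth3_cont_2d (D1 (D2 F)) (fun x _ => x) (fun _ t => t) (fun _ _ => s));
    [apply smooth3_D1, smooth3_D2, HF | exact HU | cont_tac | cont_tac | cont_tac].
- apply (smooth3_cont_2d (D2 (D1 F)) (fun x _ => x) (fun _ t => t) (fun _ _ => s));
    [apply smooth3_D2, smooth3_D1, HF | exact HU | cont_tac | cont_tac | cont_tac].
Qed.

Lemma schwarz13 F x t s : smooth3 U F -> U (x, t, s) ->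
  D1 (D3 F) x t s = D3 (D1 F) x t s.
Proof.
intros HF HU; apply (Schwarz (fun x s => F x t s) x s).
- destruct (open3_box x t s HU) as [delta Hd]; exists delta; intros u v Hu Hv.
  assert (HUv : U (u, t, v)) by (apply Hd; try assumption; apply Rabs_diag_lt).
  pose proof (HF _ _ _ HUv 2%nat) as H2; simpl in H2; tauto.
- apply (smooth3_cont_2d (D1 (D3 F)) (fun x _ => x) (fun _ _ => t) (fun _ s => s));
    [apply smooth3_D1, smooth3_D3, HF | exact HU | cont_tac | cont_tac | cont_tac].
- apply (smooth3_cont_2d (D3 (D1 F)) (fun x _ => x) (fun _ _ => t) (fun _ s => s));
    [apply smooth3_D3, smooth3_D1, HF | exact HU | cont_tac | cont_tac | cont_tac].
Qed.

Lemma schwarz23 F x t s : smooth3 U F -> U (x, t, s) ->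
  D2 (D3 F) x t s = D3 (D2 F) x t s.
Proof.
intros HF HU; apply (Schwarz (fun t s => F x t s) t s).
- destruct (open3_box x t s HU) as [delta Hd]; exists delta; intros u v Hu Hv.
  assert (HUv : U (x, u, v)) by (apply Hd; try assumption; apply Rabs_diag_lt).
  pose proof (HF _ _ _ HUv 2%nat) as H2; simpl in H2; tauto.
- apply (smooth3_cont_2d (D2 (D3 F)) (fun _ _ => x) (fun t _ => t) (fun _ s => s));
    [apply smooth3_D2, smooth3_D3, HF | exact HU | cont_tac | cont_tac | cont_tac].
- apply (smooth3_cont_2d (D3 (D2 F)) (fun _ _ => x) (fun t _ => t) (fun _ s => s));
    [apply smooth3_D3, smooth3_D2, HF | exact HU | cont_tac | cont_tac | cont_tac].
Qed.

End Smooth3.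

(** All derivatives of [f] in the geodesic equation, including the one-sided
    ones at the endpoints, are ordinary derivatives of a smooth extension. *)
Lemma curve_extension (a b : R) (f : R -> R -> R) :
  a < b -> smooth_on2 (fun p => Icc a b (snd p)) f ->
  exists U F, open U /\ smooth2 U F /\
    forall x t, Icc a b t ->
      U (x, t) /\ F x t = f x t /\
      dx f x t = dx F x t /\ dt a b f x t = dy F x t /\
      dt a b (dt a b f) x t = dy (dy F) x t /\
      dx (dt a b f) x t = dx (dy F) x t.
Proof.
intros Hab [U [F [HO [HU [HF FV]]]]].
change (smooth2 U F) in HF.
exists U, F; split; [exact HO | split; [exact HF |]].
assert (ft : forall x t, Icc a b t -> dt a b f x t = dy F x t).
{ intros x t Ht; apply (derive_in_of_is_derive a b _ (F x)); try assumption.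
  - intros r Hr; apply FV, Hr.
  - apply smooth2_ex_dy with U; auto. }
intros x t Ht; repeat split; auto.
- apply Derive_ext; intros y; symmetry; apply FV, Ht.
- apply (derive_in_of_is_derive a b _ (dy F x)); try assumption.
  + intros r Hr; symmetry; apply ft, Hr.
  + apply smooth2_ex_dy with U; [apply smooth2_dy, HF | auto].
- apply Derive_ext; intros y; apply ft, Ht.
Qed.

(** * The first variation of the energy *)

(** [f_tt f_x + 2 f_t f_tx], the Euler-Lagrange expression of the energy. *)
Definition acceleration_defect (a b : R) (f : R -> R -> R) (x t : R) : R :=
  dt a b (dt a b f) x t * dx f x t + 2 * (dt a b f x t * dx (dt a b f) x t).

(** Beyond the window the integrand is zero, so the integrals over larger intervals
    are all equal to the one over the window. *)
Lemma integral_R_support (h : R -> R) (M : R) :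
  0 <= M -> (forall x, -M <= x <= M -> continuous h x) ->
  (forall x, M < Rabs x -> h x = 0) ->
  integral_R h = RInt h (- M) M.
Proof.
intros HM Ch H0; unfold integral_R; apply is_RInt_gen_unique.
intros P HP.
apply (Filter_prod _ _ _ (fun u => u < - M) (fun v => M < v)).
- exists (- M); trivial.
- exists M; trivial.
- intros u v Hu Hv; exists (RInt h (- M) M); split; [|apply locally_singleton, HP].
  assert (Z : forall c d, (forall x, c < x < d -> h x = 0)
    -> c <= d -> is_RInt h c d 0).
  { intros c d Hcd Hle; apply is_RInt_ext with (fun _ => 0).
    - rewrite Rmin_left, Rmax_right by assumption; intros x Hx; symmetry; apply Hcd,
        Hx.
    - pose proof (@is_RInt_const R_NormedModule c d 0) as Hz.
      change (scal (d - c) 0) with ((d - c) * 0) in Hz.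
      rewrite Rmult_0_r in Hz; exact Hz. }
  simpl; replace (RInt h (- M) M) with (0 + (RInt h (- M) M + 0)) by ring.
  apply (@is_RInt_Chasles R_NormedModule h u (- M) v 0 (RInt h (- M) M + 0)).
  + apply Z; [|lra]; intros x Hx; apply H0; rewrite Rabs_left; lra.
  + apply (@is_RInt_Chasles R_NormedModule h (- M) M v (RInt h (- M) M) 0).
    * apply (@RInt_correct R_CompleteNormedModule), (ex_RInt_continuous h).
      rewrite Rmin_left, Rmax_right by lra; exact Ch.
    * apply Z; [|lra]; intros x Hx; apply H0; rewrite Rabs_pos_eq; lra.
Qed.

Lemma compact_bound (K : R -> Prop) :
  compact K -> exists M, 0 < M /\ forall x, M <= Rabs x -> ~ K x.
Proof.
intros HK; destruct (compact_P1 K HK) as [m [M H]].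
exists (Rmax (Rabs m) (Rabs M) + 1).
generalize (Rmax_l (Rabs m) (Rabs M)) (Rmax_r (Rabs m) (Rabs M)) (Rabs_pos m).
intros A B C; split; [lra|].
intros x Hx Kx; specialize (H x Kx).
revert A B C Hx; unfold Rabs; repeat destruct Rcase_abs; lra.
Qed.

(** With [V_t = F_t] and [V_x = F_x] for a smooth extension [F], the
    [s]-derivative of the integrand [F_t^2 F_x] at [s = 0] is
    [2 F_t F_x W_t + F_t^2 W_x], where [W = F_s].  This equals
    [(2 F_t F_x W)_t + (F_t^2 W)_x - 2 W (F_tt F_x + 2 F_t F_tx)], and the two
    divergence terms integrate to zero. *)
Lemma first_variation (a b : R) (f : R -> R -> R) (V : R -> R -> R -> R) :
  a < b -> smooth_curve a b f -> smooth_variation a b f V ->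
  exists M0, 0 < M0 /\ forall M, M0 <= M ->
    is_derive (fun s => energy a b (fun x t => V x t s)) 0
      (- RInt (fun t => RInt (fun x =>
           Derive (fun s => V x t s) 0 * acceleration_defect a b f x t)
           (- M) M) a b).
Proof.
intros Hab [_ [_ [Kf [HKf Hf]]]]
  [eps [Heps [[U [F [HO [HU [HF FV]]]]] [V0 [_ [[K [HK HV]] [Va Vb]]]]]]].
change (smooth3 U F) in HF.
destruct (compact_bound Kf HKf) as [M1 [HM1 B1]].
destruct (compact_bound K HK) as [M2 [HM2 B2]].
exists (Rmax M1 M2); split; [apply Rlt_le_trans with M1; [assumption |
  apply Rmax_l]|].
intros M HM.
assert (HM1' : M1 <= M) by (apply Rle_trans with (2 := HM), Rmax_l).
assert (HM2' : M2 <= M) by (apply Rle_trans with (2 := HM), Rmax_r).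
assert (inU : forall x t s, a <= t <= b -> Rabs s < eps -> U (x, t, s)).
{ intros x t s Ht Hs; apply HU; split; assumption. }
assert (VF : forall x t s, a <= t <= b -> Rabs s < eps -> F x t s = V x t s).
{ intros x t s Ht Hs; apply FV; split; assumption. }
assert (abs0 : Rabs 0 < eps) by (rewrite Rabs_R0; exact Heps).
pose proof (smooth3_D1 U F HF) as HF1.
pose proof (smooth3_D2 U F HF) as HF2.
pose proof (smooth3_D3 U F HF) as HF3.
pose proof (smooth3_D2 U _ HF2) as HF22.
pose proof (smooth3_D1 U _ HF2) as HF12.
pose proof (smooth3_D2 U _ HF3) as HF23.
pose proof (smooth3_D1 U _ HF3) as HF13.
assert (Et : forall x t s, a <= t <= b -> Rabs s < eps ->
  dt a b (fun x t => V x t s) x t = D2 F x t s).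
{ intros x t s Ht Hs.
  apply (derive_in_of_is_derive a b _ (fun r => F x r s)); try assumption.
  - intros r Hr; apply VF; assumption.
  - eexists; apply (smooth3_is_D2 U); auto. }
assert (Ex : forall x t s, a <= t <= b -> Rabs s < eps ->
  dx (fun x t => V x t s) x t = D1 F x t s).
{ intros x t s Ht Hs; apply Derive_ext; intros y; symmetry; apply VF; assumption. }
assert (Es : forall x t, a <= t <= b -> Derive (fun s => V x t s) 0 = D3 F x t 0).
{ intros x t Ht; apply Derive_ext_loc; exists (mkposreal eps Heps); intros s Hs.
  symmetry; apply VF; [assumption|].
  change (Rabs (s - 0) < eps) in Hs; rewrite Rminus_0_r in Hs; exact Hs. }
assert (ft : forall x t, a <= t <= b -> dt a b f x t = D2 F x t 0).
{ intros x t Ht; apply (derive_in_of_is_derive a b _ (fun r => F x r 0));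
    try assumption.
  - intros r Hr; rewrite VF by assumption; apply V0, Hr.
  - eexists; apply (smooth3_is_D2 U); auto. }
assert (fx : forall x t, a <= t <= b -> dx f x t = D1 F x t 0).
{ intros x t Ht; apply Derive_ext; intros y; rewrite VF by assumption;
  symmetry; apply V0, Ht. }
assert (ftt : forall x t, a <= t <= b -> dt a b (dt a b f) x t = D2 (D2 F) x t 0).
{ intros x t Ht; apply (derive_in_of_is_derive a b _ (fun r => D2 F x r 0));
    try assumption.
  - intros r Hr; symmetry; apply ft, Hr.
  - eexists; apply (smooth3_is_D2 U); auto. }
assert (ftx : forall x t, a <= t <= b -> dx (dt a b f) x t = D1 (D2 F) x t 0).
{ intros x t Ht; apply Derive_ext; intros y; apply ft, Ht. }
(* outside the window V depends on neither t nor s, at t = a, b not on s *)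
assert (Zt : forall x t s, M <= Rabs x -> a <= t <= b -> Rabs s < eps -> D2 F x t s =
  0).
{ intros x t s Hx Ht Hs; rewrite <- Et by assumption.
  unfold dt; rewrite (derive_in_of_is_derive a b _ (fun _ => f x t)); try assumption.
  - apply Derive_const.
  - intros r Hr; rewrite (HV x r s); try assumption; [|apply B2; lra].
    apply Hf; try assumption; apply B1; lra.
  - apply @ex_derive_const. }
assert (Zs : forall x t, M <= Rabs x -> a <= t <= b -> D3 F x t 0 = 0).
{ intros x t Hx Ht; rewrite <- Es by assumption.
  rewrite (Derive_ext_loc _ (fun _ => f x t)); [apply Derive_const|].
  exists (mkposreal eps Heps); intros s Hs.
  change (Rabs (s - 0) < eps) in Hs; rewrite Rminus_0_r in Hs.
  apply HV; try assumption; apply B2; lra. }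
assert (Za : forall x, D3 F x a 0 = 0).
{ intros x; rewrite <- Es by lra.
  rewrite (Derive_ext_loc _ (fun _ => f x a)); [apply Derive_const|].
  exists (mkposreal eps Heps); intros s Hs.
  change (Rabs (s - 0) < eps) in Hs; rewrite Rminus_0_r in Hs; apply Va, Hs. }
assert (Zb : forall x, D3 F x b 0 = 0).
{ intros x; rewrite <- Es by lra.
  rewrite (Derive_ext_loc _ (fun _ => f x b)); [apply Derive_const|].
  exists (mkposreal eps Heps); intros s Hs.
  change (Rabs (s - 0) < eps) in Hs; rewrite Rminus_0_r in Hs; apply Vb, Hs. }
set (H := fun x t s => D2 F x t s * D2 F x t s * D1 F x t s).
set (G := fun x t s => 2 * (D2 F x t s * D2 (D3 F) x t s * D1 F x t s)
                       + D2 F x t s * D2 F x t s * D1 (D3 F) x t s).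
assert (CC : forall L, smooth3 U L -> forall p, U p ->
  continuous (fun q : R * R * R => L (fst (fst q)) (snd (fst q)) (snd q)) p)
  by exact (fun L HL p => smooth3_cont U L p HL).
assert (CH : forall p, U p ->
  continuous (fun q : R * R * R => H (fst (fst q)) (snd (fst q)) (snd q)) p).
{ intros p Hp; unfold H; cont_tac; apply CC; assumption. }
assert (CG : forall p, U p ->
  continuous (fun q : R * R * R => G (fst (fst q)) (snd (fst q)) (snd q)) p).
{ intros p Hp; unfold G; cont_tac; apply CC; assumption. }
assert (CS : forall L, smooth3 U L -> cont_strip a b (fun x t => L x t 0)).
{ intros L HL x t Ht; apply (continuous_app3 L fst snd (fun _ => 0)); try cont_tac.
  apply CC, inU; assumption. }
assert (DH : forall x t s, U (x, t, s) -> is_derive (fun s => H x t s) s (G x t s)).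
{ intros x t s Hp; unfold H, G.
  rewrite (schwarz23 U HO F x t s HF Hp), (schwarz13 U HO F x t s HF Hp).
  pose proof (smooth3_is_D3 U _ x t s HF1 Hp) as DA.
  pose proof (smooth3_is_D3 U _ x t s HF2 Hp) as DB.
  eapply is_derive_eq.
  - apply is_derive_Rmult; [apply is_derive_Rmult; exact DB | exact DA].
  - simpl; ring. }
(* half of eps, so that values clamped to [-e, e] stay strictly inside *)
set (e := eps / 2).
assert (He : 0 < e) by (unfold e; lra).
assert (cle : forall s, Rabs (clamp (- e) e s) < eps).
{ intros s; assert (-e <= clamp (-e) e s <= e) by (apply clamp_in; lra).
  apply Rabs_def1; unfold e in *; lra. }
set (Gc := fun x t s => G x (clamp a b t) (clamp (- e) e s)).
set (Hc := fun x t => H x (clamp a b t) 0).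
assert (CGc : cont3 Gc).
{ intros p; apply (continuous_app3 G (fun q : R * R * R => fst (fst q))
    (fun q => clamp a b (snd (fst q))) (fun q => clamp (- e) e (snd q))).
  - apply CG, inU; [apply clamp_in; lra | apply cle].
  - cont_tac.
  - apply (continuous_comp (fun q : R * R * R => snd (fst q)) (clamp a b));
      [cont_tac | apply continuous_clamp].
  - apply (continuous_comp (fun q : R * R * R => snd q) (clamp (- e) e)); [cont_tac |
      apply continuous_clamp]. }
assert (CHc : cont2 Hc).
{ intros p; apply (continuous_app3 H (fun q : R * R => fst q)
    (fun q => clamp a b (snd q)) (fun q => 0)).
  - apply CH, inU; [apply clamp_in; lra | assumption].
  - cont_tac.
  - apply (continuous_comp (fun q : R * R => snd q) (clamp a b)); [cont_tac |
      apply continuous_clamp].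
  - cont_tac. }
assert (DE : is_derive (fun s => energy a b (fun x t => V x t s)) 0
   (/ 2 * RInt (fun t => RInt (fun x => Gc x t 0) (- M) M) a b)).
{ unfold energy; apply is_derive_scal.
  apply (is_derive_double_RInt Hc Gc _ a b (- M) M e); try assumption; try lra.
  intros s Hs; apply RInt_ext; rewrite Rmin_left, Rmax_right by lra; intros t Ht.
  assert (Ht' : a <= t <= b) by lra.
  assert (Hs' : Rabs s < eps) by (unfold e in *; lra).
  transitivity (integral_R (fun x => H x t s)).
  { unfold integral_R; f_equal; apply functional_extensionality; intros x.
    rewrite Et, Ex by assumption; unfold H; ring. }
  rewrite (integral_R_support _ M).
  - apply RInt_ext; intros x _.
    unfold Hc; rewrite (clamp_id a b t) by assumption.
    replace (H x t s) with (H x t 0 + (H x t s - H x t 0)) by ring; f_equal.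
    symmetry; apply is_RInt_unique.
    assert (Hr : forall r, Rmin 0 s <= r <= Rmax 0 s -> Rabs r < e).
    { intros r Hr; apply Rle_lt_trans with (2 := Hs); revert Hr.
      unfold Rmin, Rmax, Rabs; destruct Rle_dec; repeat destruct Rcase_abs; lra. }
    apply is_RInt_ext with (fun r => G x t r).
    + intros r Hrr; unfold Gc; rewrite (clamp_id a b t) by assumption.
      rewrite clamp_id; [reflexivity|].
      assert (Rabs r < e) as Hre by (apply Hr; lra).
      apply Rabs_def2 in Hre; lra.
    + apply (is_RInt_derive (fun r => H x t r) (fun r => G x t r)); intros r Hrr.
      * apply DH, inU; [assumption|]; generalize (Hr r Hrr); unfold e; lra.
      * apply (continuous_app3 G (fun _ => x) (fun _ => t) (fun r => r));
          try cont_tac.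
        apply CG, inU; [assumption|]; generalize (Hr r Hrr); unfold e; lra.
  - lra.
  - intros x _; apply (continuous_app3 H (fun x => x) (fun _ => t) (fun r => s));
      try cont_tac.
    apply CH, inU; assumption.
  - intros x Hx; unfold H; rewrite Zt by (try assumption; lra); ring. }
set (A := fun x t => D2 (D2 F) x t 0 * D1 F x t 0 + 2 * (D2 F x t 0 * D1 (D2 F)
  x t 0)).
set (WA := fun x t => D3 F x t 0 * A x t).
assert (CWA : cont_strip a b WA).
{ intros x t Ht; unfold WA, A; cont_tac; apply CS; assumption. }
assert (CG0 : cont_strip a b (fun x t => G x t 0)).
{ intros x t Ht; unfold G; cont_tac; apply CS; assumption. }
assert (EG : RInt (fun t => RInt (fun x => Gc x t 0) (- M) M) a b
           = RInt (fun t => RInt (fun x => G x t 0) (- M) M) a b).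
{ apply (double_RInt_ext (fun x t => Gc x t 0) (fun x t => G x t 0)); [lra|].
  intros x t Ht; unfold Gc; rewrite !clamp_id by lra; reflexivity. }
assert (EW : RInt (fun t => RInt (fun x =>
           Derive (fun s => V x t s) 0 * acceleration_defect a b f x t)
           (- M) M) a b = RInt (fun t => RInt (fun x => WA x t) (- M) M) a b).
{ apply (double_RInt_ext (fun x t =>
    Derive (fun s => V x t s) 0 * acceleration_defect a b f x t) WA); [lra|].
  intros x t Ht; unfold WA, A, acceleration_defect.
  rewrite Es, ft, fx, ftt, ftx by assumption; reflexivity. }
(* Pt + Qx = G + 2 WA, using the symmetry of the mixed derivatives of F *)
set (Pt := fun x t => 2 * (D2 (D2 F) x t 0 * D1 F x t 0 * D3 F x t 0
   + D2 F x t 0 * D1 (D2 F) x t 0 * D3 F x t 0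
   + D2 F x t 0 * D1 F x t 0 * D2 (D3 F) x t 0)).
set (Qx := fun x t => 2 * (D2 F x t 0 * D1 (D2 F) x t 0) * D3 F x t 0
   + D2 F x t 0 * D2 F x t 0 * D1 (D3 F) x t 0).
assert (Z : RInt (fun t => RInt (fun x => Pt x t + Qx x t) (- M) M) a b = 0).
{ apply (divergence_zero (fun x t => 2 * (D2 F x t 0 * D1 F x t 0 * D3 F x t 0))
    (fun x t => D2 F x t 0 * D2 F x t 0 * D3 F x t 0)); try lra.
  - intros x t Ht; assert (Hp := inU x t 0 Ht abs0); unfold Pt.
    rewrite (schwarz12 U HO F x t 0 HF Hp).
    pose proof (smooth3_is_D2 U _ x t 0 HF1 Hp) as DA.
    pose proof (smooth3_is_D2 U _ x t 0 HF2 Hp) as DB.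
    pose proof (smooth3_is_D2 U _ x t 0 HF3 Hp) as DC.
    eapply is_derive_eq.
    + apply is_derive_scal, is_derive_Rmult; [|exact DC].
      apply is_derive_Rmult; [exact DB | exact DA].
    + simpl; ring.
  - intros x t Ht; assert (Hp := inU x t 0 Ht abs0); unfold Qx.
    pose proof (smooth3_is_D1 U _ x t 0 HF2 Hp) as DB.
    pose proof (smooth3_is_D1 U _ x t 0 HF3 Hp) as DC.
    eapply is_derive_eq.
    + apply is_derive_Rmult; [apply is_derive_Rmult; exact DB | exact DC].
    + simpl; ring.
  - intros x t Ht; unfold Pt; cont_tac; apply CS; assumption.
  - intros x t Ht; unfold Qx; cont_tac; apply CS; assumption.
  - intros x; rewrite Za; ring.
  - intros x; rewrite Zb; ring.
  - intros t Ht; rewrite Zs; [ring | rewrite Rabs_Ropp; apply Rle_abs | assumption].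
  - intros t Ht; rewrite Zs; [ring | apply Rle_abs | assumption]. }
rewrite (double_RInt_ext _ (fun x t => G x t 0 + (WA x t + WA x t))) in Z;
  [|lra|intros x t Ht; unfold Pt, Qx, G, WA, A; ring].
rewrite (double_RInt_plus (fun x t => G x t 0) (fun x t => WA x t + WA x t)) in Z;
  [|lra|assumption|intros x t Ht; apply continuous_Rplus; apply CWA, Ht].
rewrite (double_RInt_plus WA WA) in Z by (assumption || lra).
rewrite EW.
replace (- RInt (fun t => RInt (fun x => WA x t) (- M) M) a b)
  with (/ 2 * RInt (fun t => RInt (fun x => Gc x t 0) (- M) M) a b); [exact DE|].
rewrite EG; lra.
Qed.

Lemma metric_energy_eq (a b : R) (f : R -> R -> R) :
  a <= b -> (forall t x, Icc a b t -> 0 < dx f x t) ->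
  energy a b f = metric_energy a b f.
Proof.
intros Hab Hpos; unfold energy, metric_energy; f_equal.
apply RInt_ext; rewrite Rmin_left, Rmax_right by assumption; intros t Ht.
unfold metric_G; f_equal; apply functional_extensionality; intros x.
rewrite (Rabs_pos_eq (Derive (fun x => f x t) x)).
- unfold dx; ring.
- apply Rlt_le, (Hpos t x); unfold Icc; lra.
Qed.

Lemma geodesic_critical_point (a b : R) (f : R -> R -> R) :
  a < b -> critical_point (energy a b) a b f <-> geodesic a b f.
Proof.
intros Hab.
assert (HE : forall V, smooth_variation a b f V ->
  locally 0 (fun s => energy a b (fun x t => V x t s)
    = metric_energy a b (fun x t => V x t s))).
{ intros V [eps [Heps [_ [_ [Hemb _]]]]].
  exists (mkposreal eps Heps); intros s Hs.
  change (Rabs (s - 0) < eps) in Hs; rewrite Rminus_0_r in Hs.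
  apply metric_energy_eq; [lra|]; intros t x Ht; apply (Hemb t s Ht Hs). }
split; intros H V HV.
- apply is_derive_ext_loc with (2 := H V HV); apply HE, HV.
- apply is_derive_ext_loc with (2 := H V HV).
  apply filter_imp with (2 := HE V HV); intros s Es; symmetry; exact Es.
Qed.

Lemma geodesic_equation_defect (a b : R) (f : R -> R -> R) :
  smooth_curve a b f ->
  geodesic_equation a b f <->
  (forall x t, Icc a b t -> acceleration_defect a b f x t = 0).
Proof.
intros [_ [Hemb _]].
assert (Hpos : forall x t, Icc a b t -> 0 < dx f x t) by (intros x t Ht;
  apply (Hemb t Ht)).
split; intros H x t Ht; specialize (H x t Ht); specialize (Hpos x t Ht);
  unfold acceleration_defect in *.
- rewrite H; field; lra.
- apply (Rmult_eq_reg_r (dx f x t)); [|lra].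
  replace (-2 * (dt a b f x t * dx (dt a b f) x t / dx f x t) * dx f x t)
    with (- (2 * (dt a b f x t * dx (dt a b f) x t))) by (field; lra).
  lra.
Qed.

Lemma defect_critical_point (a b : R) (f : R -> R -> R) :
  a < b -> smooth_curve a b f ->
  (forall x t, Icc a b t -> acceleration_defect a b f x t = 0) ->
  critical_point (energy a b) a b f.
Proof.
intros Hab Hf H0 V HV.
destruct (first_variation a b f V Hab Hf HV) as [M [HM HD]].
eapply is_derive_eq; [apply (HD M (Rle_refl M))|].
rewrite <- Ropp_0; f_equal.
apply RInt_eq_zero; [lra|]; intros t Ht.
apply RInt_eq_zero; [lra|]; intros x _.
rewrite H0 by exact Ht; apply Rmult_0_r.
Qed.

(** * Smooth bump functions *)

(** The function [exp (- 1 / x) / x ^ n] for positive [x], extended by zero: the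
    powers of [1 / x] make the family closed under differentiation up to linear
    combinations. *)
Definition flat (n : nat) (x : R) : R :=
  if Rlt_dec 0 x then (/ x) ^ n * exp (- / x) else 0.

Lemma pow_le_exp (k : nat) (y : R) : 0 <= y -> y ^ k <= INR (fact k) * exp y.
Proof.
intros Hy.
assert (Hf : 0 < INR (fact k)) by apply INR_fact_lt_0.
assert (H : y ^ k / INR (fact k) <= exp y).
{ apply Rle_trans with (2 := exp_ge_taylor y k Hy).
  assert (Hpos : forall j, 0 <= y ^ j / INR (fact j)).
  { intros j; apply Rdiv_le_0_compat; [apply pow_le, Hy | apply INR_fact_lt_0]. }
  destruct k as [|k]; [apply Rle_refl|].
  rewrite tech5.
  generalize (cond_pos_sum (fun j => y ^ j / INR (fact j)) k Hpos); lra. }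
apply (Rmult_le_compat_l (INR (fact k))) in H; [|lra].
replace (INR (fact k) * (y ^ k / INR (fact k))) with (y ^ k) in H by (field; lra).
exact H.
Qed.

(** A quadratic bound at the origin, whence the derivative there is zero. *)
Lemma flat_bound (n : nat) (x : R) : Rabs (flat n x) <= INR (fact (n + 2)) * x ^ 2.
Proof.
assert (Hf : 0 < INR (fact (n + 2))) by apply INR_fact_lt_0.
unfold flat; destruct (Rlt_dec 0 x) as [Hx|Hx].
- assert (Hy : 0 < / x) by (apply Rinv_0_lt_compat, Hx).
  assert (He := exp_pos (- / x)).
  rewrite Rabs_pos_eq.
  2:{ apply Rmult_le_pos; [apply pow_le|]; lra. }
  assert (H := pow_le_exp (n + 2) (/ x) ltac:(lra)).
  replace ((/ x) ^ n * exp (- / x))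
    with ((/ x) ^ (n + 2) * (exp (- / x) * x ^ 2)).
  2:{ rewrite pow_add; field; lra. }
  apply Rle_trans with (INR (fact (n + 2)) * exp (/ x) * (exp (- / x) * x ^ 2)).
  + apply Rmult_le_compat_r; [|assumption].
    apply Rmult_le_pos; [lra | apply pow2_ge_0].
  + rewrite exp_Ropp; right; field; apply Rgt_not_eq, exp_pos.
- rewrite Rabs_R0; apply Rmult_le_pos; [lra | apply pow2_ge_0].
Qed.

Lemma is_derive_flat (n : nat) (x : R) :
  is_derive (flat n) x (flat (S (S n)) x + - INR n * flat (S n) x).
Proof.
destruct (Rtotal_order x 0) as [Hx|[Hx|Hx]].
- apply is_derive_ext_loc with (fun _ => 0).
  + exists (mkposreal (- x) ltac:(lra)); intros y Hy.
    change (Rabs (y - x) < - x) in Hy; apply Rabs_def2 in Hy.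
    unfold flat; destruct (Rlt_dec 0 y); [lra | reflexivity].
  + unfold flat; destruct (Rlt_dec 0 x); [lra|].
    eapply is_derive_eq; [apply @is_derive_const | unfold zero; simpl; ring].
- subst x; apply is_derive_Reals; intros eps Heps.
  set (C := INR (fact (n + 2))).
  assert (HC : 0 < C) by apply INR_fact_lt_0.
  exists (mkposreal (eps / C) (Rdiv_lt_0_compat _ _ Heps HC)); intros h Hh Hlt;
    simpl in Hlt.
  assert (F0 : forall m, flat m 0 = 0)
    by (intros m; unfold flat; destruct (Rlt_dec 0 0); [lra | reflexivity]).
  rewrite !F0, Rplus_0_l.
  replace ((flat n h - 0) / h - (0 + - INR n * 0)) with (flat n h / h) by (field;
    exact Hh).
  rewrite Rabs_div by exact Hh.
  assert (Hah : 0 < Rabs h) by (apply Rabs_pos_lt, Hh).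
  apply Rmult_lt_reg_r with (Rabs h); [assumption|].
  replace (Rabs (flat n h) / Rabs h * Rabs h) with (Rabs (flat n h)) by (field; lra).
  apply Rle_lt_trans with (1 := flat_bound n h); fold C.
  rewrite <- (pow2_abs h).
  replace (C * Rabs h ^ 2) with (C * Rabs h * Rabs h) by ring.
  apply Rmult_lt_compat_r; [assumption|].
  apply (Rmult_lt_compat_l C) in Hlt; [|assumption].
  replace (C * (eps / C)) with eps in Hlt by (field; lra); exact Hlt.
- apply is_derive_ext_loc with (fun y => (/ y) ^ n * exp (- / y)).
  + exists (mkposreal x Hx); intros y Hy.
    change (Rabs (y - x) < x) in Hy; apply Rabs_def2 in Hy.
    unfold flat; destruct (Rlt_dec 0 y); [reflexivity | lra].
  + unfold flat; destruct (Rlt_dec 0 x); [|lra].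
    auto_derive; [repeat split; lra|].
    destruct n as [|n]; simpl pred; [simpl; field; lra|].
    rewrite <- !tech_pow_Rmult; field; lra.
Qed.

(** Closed under differentiation by construction, so that mere differentiability
    of its members already makes the bump functions smooth. *)
Inductive bump_algebra : (R -> R) -> Prop :=
| bump_const c : bump_algebra (fun _ => c)
| bump_flat n u v : bump_algebra (fun x => flat n (u * x + v))
| bump_plus g h : bump_algebra g -> bump_algebra h ->
    bump_algebra (fun x => g x + h x)
| bump_mult g h : bump_algebra g -> bump_algebra h ->
    bump_algebra (fun x => g x * h x).

Lemma bump_algebra_derive (g : R -> R) : bump_algebra g ->
  exists g', bump_algebra g' /\ forall x, is_derive g x (g' x).
Proof.
induction 1 as [c | n u v | g h _ [g' [Bg Dg]] _ [h' [Bh Dh]]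
               | g h Ag [g' [Bg Dg]] Ah [h' [Bh Dh]]].
- exists (fun _ => 0); split; [constructor | intros x; apply @is_derive_const].
- exists (fun x => u * (flat (S (S n)) (u * x + v) + - INR n * flat (S n)
    (u * x + v))).
  split; [repeat constructor|].
  intros x; apply (is_derive_comp (flat n) (fun x => u * x + v));
    [apply is_derive_flat|].
  auto_derive; [exact I | ring].
- exists (fun x => g' x + h' x); split; [constructor; assumption|].
  intros x; apply @is_derive_plus; [apply Dg | apply Dh].
- exists (fun x => g' x * h x + g x * h' x); split; [repeat constructor; assumption|].
  intros x; apply is_derive_Rmult; [apply Dg | apply Dh].
Qed.

Lemma bump_algebra_smooth (g : R -> R) : bump_algebra g -> smooth1 g.
Proof.
intros Hg.
assert (HD : forall n, bump_algebra (Derive_n g n)).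
{ induction n as [|n IH]; [exact Hg|].
  destruct (bump_algebra_derive _ IH) as [g' [Bg Dg]].
  replace (Derive_n g (S n)) with g'; [exact Bg|].
  apply functional_extensionality; intros x; symmetry; apply is_derive_unique, Dg. }
intros [|n] x; [exact I|].
destruct (bump_algebra_derive _ (HD n)) as [g' [_ Dg]].
exists (g' x); apply Dg.
Qed.

Definition bump (p q x : R) : R := flat 0 (1 * x + - p) * flat 0 (-1 * x + q).

Lemma flat_pos n x : 0 < x -> 0 < flat n x.
Proof.
intros Hx; unfold flat; destruct (Rlt_dec 0 x); [|lra].
apply Rmult_lt_0_compat; [apply pow_lt, Rinv_0_lt_compat, Hx | apply exp_pos].
Qed.

Lemma flat_zero n x : x <= 0 -> flat n x = 0.
Proof. intros Hx; unfold flat; destruct (Rlt_dec 0 x); [lra | reflexivity]. Qed.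

Lemma bump_pos p q x : p < x < q -> 0 < bump p q x.
Proof. intros H; apply Rmult_lt_0_compat; apply flat_pos; lra. Qed.

Lemma bump_zero p q x : ~ p < x < q -> bump p q x = 0.
Proof.
intros H; unfold bump.
destruct (Rle_dec x p); [rewrite (flat_zero 0 (1 * x + - p)) by lra; ring|].
rewrite (flat_zero 0 (-1 * x + q)) by lra; ring.
Qed.

(** * Embeddings of the line *)

Lemma inverse_eq (g : R -> R) (x y : R) :
  (forall u v, g u = g v -> u = v) -> g x = y -> inverse g y = x.
Proof.
intros Hinj Hy; apply (@iota_unique R_AbsRing R_CompleteNormedModule); [|exact Hy].
intros z Hz; apply Hinj; rewrite Hz, Hy; reflexivity.
Qed.

Lemma increasing_of_Derive_pos (g : R -> R) :
  smooth1 g -> (forall x, 0 < Derive g x) -> forall x y, x < y -> g x < g y.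
Proof.
intros Hg Hpos x y Hxy.
apply (incr_function g m_infty p_infty (Derive g)); simpl; trivial.
- intros z _ _; apply Derive_correct, smooth1_ex, Hg.
- intros z _ _; apply Hpos.
Qed.

Lemma Emb_plus_of_Derive_pos (g : R -> R) :
  smooth1 g -> (forall x, 0 < Derive g x) -> Emb_plus g.
Proof.
intros Hg Hpos.
assert (Hinc := increasing_of_Derive_pos g Hg Hpos).
assert (Hinj : forall u v, g u = g v -> u = v).
{ intros u v Huv; destruct (Rtotal_order u v) as [H|[H|H]]; [|exact H|];
    apply Hinc in H; lra. }
split; [|exact Hpos].
split; [exact Hg|split; [|split; [exact Hinj|]]].
- intros x; generalize (Hpos x); lra.
- intros x; apply filterlim_locally; intros eps.
  assert (He := cond_pos eps).
  assert (H1 := Hinc (x - eps) x ltac:(lra)).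
  assert (H2 := Hinc x (x + eps) ltac:(lra)).
  exists (mkposreal (Rmin (g x - g (x - eps)) (g (x + eps) - g x))
    ltac:(apply Rmin_glb_lt; lra)).
  intros y Hy [z ->].
  change (Rabs (g z - g x) < Rmin (g x - g (x - eps)) (g (x + eps) - g x)) in Hy.
  assert (Hl := Rmin_l (g x - g (x - eps)) (g (x + eps) - g x)).
  assert (Hr := Rmin_r (g x - g (x - eps)) (g (x + eps) - g x)).
  apply Rabs_def2 in Hy.
  rewrite (inverse_eq g z (g z) Hinj eq_refl).
  change (Rabs (z - x) < eps); apply Rabs_def1.
  + destruct (Rlt_dec z (x + eps)) as [Hlt|Hge]; [lra|].
    destruct (Req_dec z (x + eps)) as [->|Hne]; [lra|].
    assert (H3 := Hinc (x + eps) z ltac:(lra)); lra.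
  + destruct (Rlt_dec (x - eps) z) as [Hlt|Hge]; [lra|].
    destruct (Req_dec z (x - eps)) as [->|Hne]; [lra|].
    assert (H3 := Hinc z (x - eps) ltac:(lra)); lra.
Qed.

(** The intermediate value theorem puts a preimage of [x] within [d] of [y0]. *)
Lemma inverse_near (g : R -> R) (y0 d x : R) :
  smooth1 g -> (forall y, 0 < Derive g y) -> 0 < d ->
  g (y0 - d) < x < g (y0 + d) ->
  g (inverse g x) = x /\ Rabs (inverse g x - y0) < d.
Proof.
intros Hg Hpos Hd Hx.
assert (Hinc := increasing_of_Derive_pos g Hg Hpos).
destruct (IVT_gen g (y0 - d) (y0 + d) x) as [z [Hz Ez]].
- intros y; apply continuity_pt_filterlim, smooth1_cont, Hg.
- rewrite Rmin_left, Rmax_right; lra.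
- rewrite Rmin_left, Rmax_right in Hz by lra.
  rewrite (inverse_eq g z x); [|intros u v Huv|exact Ez].
  + split; [exact Ez|].
    assert (z <> y0 - d) by (intros ->; lra).
    assert (z <> y0 + d) by (intros ->; lra).
    apply Rabs_def1; lra.
  + destruct (Rtotal_order u v) as [H|[H|H]]; [|exact H|]; apply Hinc in H; lra.
Qed.

(** * Test variations *)

Lemma is_derive_Rscal_r (g : R -> R) (x l c : R) :
  is_derive g x l -> is_derive (fun z => g z * c) x (l * c).
Proof. exact (fun H => is_derive_scal_l g x l c H). Qed.

(** The functions that agree on [U] with [G(x,t) + p(s) al(x) be(t)], all
    ingredients being smooth, are stable under the three partial
    derivatives; induction on the order then needs no product rule for higher
    derivatives. *)
Lemma smooth3_linear_variation (U : R * R -> Prop) (F : R -> R -> R)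
    (al be : R -> R) :
  open U -> smooth2 U F -> smooth1 al -> smooth1 be ->
  smooth3 (fun p => U (fst p)) (fun x t s => F x t + s * (al x * be t)).
Proof.
intros HO HF Hal Hbe.
enough (HS : forall n (p al be : R -> R) G K,
  smooth1 p -> smooth1 al -> smooth1 be -> smooth2 U G ->
  (forall x t s, U (x, t) -> K x t s = G x t + p s * (al x * be t)) ->
  forall x t s, U (x, t) -> ex_diff3_n K n x t s).
{ intros x t s HU n.
  apply (HS n (fun s => s) al be F); try assumption; [apply smooth1_id|reflexivity]. }
clear F HF al be Hal Hbe; intros n.
induction n as [|n IH]; intros p al be G K Hp Hal Hbe HG HK x t s HU.
all: assert (Hloc : exists delta : posreal, forall u v, Rabs (u - x) < delta ->
         Rabs (v - t) < delta -> U (u, v))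
     by (destruct (HO _ HU) as [delta Hd]; exists delta; intros u v Hu Hv;
         apply Hd; split; assumption);
  destruct Hloc as [delta Hd].
all: assert (Cx : forall q : R * R * R, continuous (fun q : R * R * R => al (fst (fst
  q))) q)
  by (intros q; apply (continuous_comp (fun q : R * R * R => fst (fst q)) al);
      [cont_tac | apply smooth1_cont, Hal]).
all: assert (Ct : forall q : R * R * R, continuous (fun q : R * R * R => be (snd (fst
  q))) q)
  by (intros q; apply (continuous_comp (fun q : R * R * R => snd (fst q)) be);
      [cont_tac | apply smooth1_cont, Hbe]).
all: assert (Cs : forall q : R * R * R, continuous (fun q : R * R * R => p (snd q)) q)
  by (intros q; apply (continuous_comp (fun q : R * R * R => snd q) p);
      [cont_tac | apply smooth1_cont, Hp]).
all: assert (CK : continuous (fun q : R * R * R => K (fst (fst q)) (snd (fst q))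
  (snd q)) (x, t, s)).
1, 3: apply continuous_ext_loc with (fun q : R * R * R =>
       G (fst (fst q)) (snd (fst q)) + p (snd q) * (al (fst (fst q))
         * be (snd (fst q))));
  [ exists delta; intros [[u v] w] [[Hu Hv] Hw]; symmetry; apply HK, Hd; assumption
  | apply continuous_Rplus;
    [ apply (continuous_comp fst (fun q : R * R => G (fst q) (snd q)));
      [cont_tac | apply smooth2_cont with U; assumption]
    | apply continuous_Rmult; [apply Cs | apply continuous_Rmult; [apply Cx |
      apply Ct]]]].
- split; [exact CK | exact I].
- assert (E1 : forall x t s, U (x, t) -> is_derive (fun z => K z t s) x
      (dx G x t + p s * (Derive al x * be t))).
  { clear - HK HO HG Hal; intros x t s HU.
    apply is_derive_ext_loc with (fun z => G z t + p s * (al z * be t)).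
    - destruct (HO _ HU) as [delta Hd]; exists delta; intros u Hu.
      symmetry; apply HK, Hd; split; [exact Hu | apply ball_center].
    - apply @is_derive_plus; [apply Derive_correct, smooth2_ex_dx with U;
        assumption|].
      apply is_derive_scal, is_derive_Rscal_r, Derive_correct, smooth1_ex, Hal. }
  assert (E2 : forall x t s, U (x, t) -> is_derive (fun z => K x z s) t
      (dy G x t + p s * (al x * Derive be t))).
  { clear - HK HO HG Hbe; intros x t s HU.
    apply is_derive_ext_loc with (fun z => G x z + p s * (al x * be z)).
    - destruct (HO _ HU) as [delta Hd]; exists delta; intros u Hu.
      symmetry; apply HK, Hd; split; [apply ball_center | exact Hu].
    - apply @is_derive_plus; [apply Derive_correct, smooth2_ex_dy with U;
        assumption|].
      apply is_derive_scal, is_derive_scal, Derive_correct, smooth1_ex, Hbe. }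
  assert (E3 : forall x t s, U (x, t) -> is_derive (fun z => K x t z) s
      (0 + Derive p s * (al x * be t))).
  { clear - HK Hp; intros x t s HU.
    apply is_derive_ext with (fun z => G x t + p z * (al x * be t)).
    - intros u; symmetry; apply HK, HU.
    - apply @is_derive_plus; [apply @is_derive_const|].
      apply is_derive_Rscal_r, Derive_correct, smooth1_ex, Hp. }
  split; [exact CK|].
  split; [eexists; apply E1, HU|].
  split; [eexists; apply E2, HU|].
  split; [eexists; apply E3, HU|].
  split; [|split].
  + apply (IH p (Derive al) be (dx G)); try assumption;
      [apply smooth1_Derive, Hal | apply smooth2_dx, HG |].
    intros u v w Huv; apply is_derive_unique, E1, Huv.
  + apply (IH p al (Derive be) (dy G)); try assumption;
      [apply smooth1_Derive, Hbe | apply smooth2_dy, HG |].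
    intros u v w Huv; apply is_derive_unique, E2, Huv.
  + apply (IH (Derive p) al be (fun _ _ => 0)); try assumption;
      [apply smooth1_Derive, Hp | |].
    * intros u v _ m; clear; revert u v.
      induction m as [|m IHm]; intros u v; (split; [apply continuity_2d_pt_const|]);
        [exact I|].
      split; [apply @ex_derive_const|split; [apply @ex_derive_const|]].
      replace (fun u v : R => Derive (fun _ => 0) u) with (fun _ _ : R => 0).
      2:{ apply functional_extensionality; intros y; apply functional_extensionality;
          intros z; symmetry; apply Derive_const. }
      replace (fun u v : R => Derive (fun _ => 0) v) with (fun _ _ : R => 0).
      2:{ apply functional_extensionality; intros y; apply functional_extensionality;
          intros z; symmetry; apply Derive_const. }
      split; apply IHm.
    * intros u v w Huv; apply is_derive_unique, E3, Huv.
Qed.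

(** Continuity together with compactness, used once in [x] and once in [t]. *)
Lemma uniform_positivity (N : R -> R -> R -> R) (a b c d : R) :
  cont3 N -> (forall x t, 0 < N x t 0) ->
  exists eta : posreal, forall x t s,
    c <= x <= d -> a <= t <= b -> Rabs s < eta -> 0 < N x t s.
Proof.
intros CN HN.
destruct (compact_uniform a b 0 (fun t s => forall x, c <= x <= d -> 0 < N x t s))
  as [eta Heta].
- intros t.
  destruct (compact_uniform c d (t, 0) (fun x (q : R * R) => 0 < N x (fst q) (snd q)))
    as [delta Hdelta].
  + intros x.
    destruct (proj1 (filterlim_locally _ _) (CN (x, t, 0)) (mkposreal _ (HN x t)))
      as [del Hdel].
    exists del; intros y [r s] Hy [Hr Hs].
    assert (B : Rabs (N y r s - N x t 0) < N x t 0)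
      by (apply (Hdel (y, r, s)); repeat split; assumption).
    apply Rabs_def2 in B; simpl; lra.
  + exists delta; intros r s Hr Hs x Hx.
    apply (Hdelta x (r, s) Hx); split; assumption.
- exists eta; intros x t s Hx Ht Hs; apply (Heta t s Ht); [|exact Hx].
  change (Rabs (s - 0) < eta); rewrite Rminus_0_r; exact Hs.
Qed.

(** On the support of [al] the slope [f_x + s al' be] stays positive for small
    [s] by compactness; elsewhere it is [f_x]. *)
Lemma linear_smooth_variation (a b : R) (f : R -> R -> R) (al be : R -> R)
    (p q : R) :
  a < b -> smooth_curve a b f -> smooth1 al -> smooth1 be ->
  (forall x, ~ p < x < q -> al x = 0) -> be a = 0 -> be b = 0 ->
  smooth_variation a b f (fun x t s => f x t + s * (al x * be t)).
Proof.
intros Hab [Hs [Hemb _]] Hal Hbe Zal Za Zb.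
destruct (curve_extension a b f Hab Hs) as [U [F [HO [HF HE]]]].
(* the space derivative of the variation, made global by clamping *)
set (N := fun x t s => dx F x (clamp a b t) + s * (Derive al x * be t)).
assert (Cin : forall t, Icc a b (clamp a b t)) by (intros t; apply clamp_in; lra).
destruct (uniform_positivity N a b p q) as [eta Heta].
- assert (CF : cont2 (fun x t => dx F x (clamp a b t))).
  { apply cont_strip_clamp; [lra|]; intros x t Ht.
    apply smooth2_cont with U; [apply smooth2_dx, HF | apply (HE x t Ht)]. }
  intros r; unfold N; apply continuous_Rplus.
  + apply (cont2_app (fun x t => dx F x (clamp a b t))
      (fun r : R * R * R => fst (fst r))
      (fun r => snd (fst r)) r CF); cont_tac.
  + apply continuous_Rmult; [cont_tac | apply continuous_Rmult].
    * apply (continuous_comp (fun r : R * R * R => fst (fst r)) (Derive al));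
        [cont_tac | apply smooth1_cont, smooth1_Derive, Hal].
    * apply (continuous_comp (fun r : R * R * R => snd (fst r)) be);
        [cont_tac | apply smooth1_cont, Hbe].
- intros x t; unfold N; rewrite Rmult_0_l, Rplus_0_r.
  destruct (HE x _ (Cin t)) as [_ [_ [<- _]]].
  apply (Hemb _ (Cin t)).
- exists eta; split; [apply cond_pos|].
  split; [|split; [|split; [|split; [|split]]]].
  + exists (fun r => U (fst r)), (fun x t s => F x t + s * (al x * be t)).
    split; [|split; [|split]].
    * apply open_comp; [intros r _; apply continuous_fst' | exact HO].
    * intros x t s [Ht _]; apply (HE x t Ht).
    * apply smooth3_linear_variation; assumption.
    * intros x t s [Ht _]; simpl; destruct (HE x t Ht) as [_ [-> _]]; reflexivity.
  + intros x t _; ring.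
  + intros t s Ht Hsm.
    destruct (Hemb t Ht) as [[Hsf _] Hpos].
    assert (Hsl : smooth1 (fun x => s * be t * al x)).
    { intros n x; apply ex_derive_n_scal_l, Hal. }
    apply Emb_plus_of_Derive_pos.
    * intros n x; apply (ex_derive_n_ext (fun x => f x t + s * be t * al x)).
      { intros y; ring. }
      apply ex_derive_n_plus; apply filter_forall; intros y k _;
        [apply Hsf | apply Hsl].
    * intros x.
      assert (D : Derive (fun x => f x t + s * (al x * be t)) x
                  = dx f x t + s * (Derive al x * be t)).
      { apply is_derive_unique, @is_derive_plus.
        - apply Derive_correct, (Hsf 1%nat).
        - apply is_derive_scal, is_derive_Rscal_r, Derive_correct, smooth1_ex, Hal. }
      rewrite D.
      destruct (classic (p <= x <= q)) as [Hx|Hx].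
      { generalize (Heta x t s Hx Ht Hsm); unfold N.
        rewrite clamp_id by exact Ht; destruct (HE x t Ht) as [_ [_ [-> _]]];
          trivial. }
      replace (Derive al x) with 0.
      { replace (dx f x t + s * (0 * be t)) with (dx f x t) by ring; apply Hpos. }
      rewrite (Derive_ext_loc al (fun _ => 0)); [symmetry; apply Derive_const|].
      assert (Hr : 0 < Rmax (p - x) (x - q)).
      { destruct (Rlt_dec x p); [apply Rlt_le_trans with (2 := Rmax_l _ _)
          |apply Rlt_le_trans with (2 := Rmax_r _ _)]; lra. }
      exists (mkposreal _ Hr); intros y Hy; apply Zal.
      change (Rabs (y - x) < Rmax (p - x) (x - q)) in Hy.
      revert Hy; unfold Rmax, Rabs; destruct Rle_dec; destruct Rcase_abs; lra.
  + exists (fun c => p <= c <= q); split; [apply compact_P3|].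
    intros x t s Hx _ _; rewrite Zal by lra; ring.
  + intros x s _; rewrite Za; ring.
  + intros x s _; rewrite Zb; ring.
Qed.

(** Test with [al be], where [al] carries the sign of the defect at the chosen
    point and both factors are supported where the defect keeps that sign; then
    the first variation is the integral of a nonzero function of one sign.  At an
    endpoint [t0] the box is cut down to [[a,b]], so that [be] still vanishes at
    [a] and [b]. *)
Lemma critical_point_defect (a b : R) (f : R -> R -> R) :
  a < b -> smooth_curve a b f -> critical_point (energy a b) a b f ->
  forall x t, Icc a b t -> acceleration_defect a b f x t = 0.
Proof.
intros Hab Hf Hcrit x0 t0 Ht0.
destruct (Req_dec (acceleration_defect a b f x0 t0) 0) as [H0|H0]; [exact H0|exfalso].
destruct (curve_extension a b f Hab (proj1 Hf)) as [U [F [HO [HF HE]]]].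
set (A := fun x t => dy (dy F) x t * dx F x t + 2 * (dy F x t * dx (dy F) x t)).
assert (EA : forall x t, Icc a b t -> acceleration_defect a b f x t = A x t).
{ intros x t Ht; destruct (HE x t Ht) as [_ [_ [E1 [E2 [E3 E4]]]]].
  unfold acceleration_defect, A; rewrite E1, E2, E3, E4; reflexivity. }
assert (CA : cont_strip a b A).
{ intros x t Ht; destruct (HE x t Ht) as [HU _].
  pose proof (smooth2_dy U F HF) as HFt.
  unfold A; cont_tac; apply smooth2_cont with U; try assumption.
  - apply smooth2_dy, HFt.
  - apply smooth2_dx, HF.
  - apply smooth2_dx, HFt. }
set (sg := A x0 t0).
assert (Hsg : sg <> 0) by (unfold sg; rewrite <- EA by assumption; exact H0).
destruct (proj1 (filterlim_locally _ _) (CA x0 t0 Ht0)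
  (mkposreal _ (Rabs_pos_lt sg Hsg)))
  as [delta Hdelta].
assert (Hd := cond_pos delta).
assert (Apos : forall x t, Rabs (x - x0) < delta -> Rabs (t - t0) < delta ->
  0 < sg * A x t).
{ intros x t Hx Ht.
  assert (B : Rabs (A x t - sg) < Rabs sg) by (apply (Hdelta (x, t)); split;
    assumption).
  assert (B2 := Rabs_pos_lt sg Hsg).
  (* sg * A is within sg^2 of sg^2 *)
  replace (sg * A x t) with (Rabs sg * Rabs sg + sg * (A x t - sg)).
  2:{ rewrite <- Rabs_mult, Rabs_pos_eq by apply Rle_0_sqr; ring. }
  assert (B3 : Rabs (sg * (A x t - sg)) < Rabs sg * Rabs sg).
  { rewrite Rabs_mult; apply Rmult_lt_compat_l; assumption. }
  apply Rabs_def2 in B3; lra. }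
set (p1 := x0 - delta); set (q1 := x0 + delta).
set (p2 := Rmax a (t0 - delta)); set (q2 := Rmin b (t0 + delta)).
destruct Ht0 as [Ha0 Hb0].
assert (P2 : a <= p2 /\ t0 - delta <= p2 /\ p2 < b /\ p2 < t0 + delta).
{ unfold p2; repeat split; [apply Rmax_l | apply Rmax_r | apply Rmax_lub_lt;
    lra ..]. }
assert (Q2 : q2 <= b /\ q2 <= t0 + delta /\ p2 < q2).
{ unfold q2; repeat split; [apply Rmin_l | apply Rmin_r | apply Rmin_glb_lt; lra]. }
set (al := fun x => sg * bump p1 q1 x); set (be := bump p2 q2).
assert (Hal : smooth1 al) by (apply bump_algebra_smooth; repeat constructor).
assert (Hbe : smooth1 be) by (apply bump_algebra_smooth; repeat constructor).
assert (Zal : forall x, ~ p1 < x < q1 -> al x = 0).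
{ intros x Hx; unfold al; rewrite bump_zero by exact Hx; ring. }
assert (HV := linear_smooth_variation a b f al be p1 q1 Hab Hf Hal Hbe Zal
  ltac:(apply bump_zero; lra) ltac:(apply bump_zero; lra)).
destruct (first_variation a b f _ Hab Hf HV) as [M0 [HM0 HM]].
(* a window for which the formula holds and that contains the support *)
set (M := Rmax M0 (Rabs x0 + delta)).
assert (HM1 : M0 <= M) by apply Rmax_l.
assert (HM2 : Rabs x0 + delta <= M) by apply Rmax_r.
assert (Hx0 := Rle_abs x0); assert (Hx0' := Rle_abs (- x0));
  rewrite Rabs_Ropp in Hx0'.
assert (E := is_derive_unique _ _ _ (HM M HM1)).
rewrite (is_derive_unique _ _ _ (Hcrit _ HV)) in E.
set (h := fun x t => al x * be t * A x (clamp a b t)).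
assert (Ch : cont2 h).
{ assert (CA' := cont_strip_clamp a b A ltac:(lra) CA).
  intros r; unfold h; apply continuous_Rmult; [apply continuous_Rmult|].
  - apply (continuous_comp fst al); [cont_tac | apply smooth1_cont, Hal].
  - apply (continuous_comp snd be); [cont_tac | apply smooth1_cont, Hbe].
  - apply CA'. }
assert (Ipos : 0 < RInt (fun t => RInt (fun x => h x t) (- M) M) a b).
{ apply RInt_pos_of_bump with p2 q2; try lra.
  - apply (continuous_RInt_param h); exact Ch.
  - intros t Ht; apply RInt_pos_of_bump with p1 q1; unfold p1, q1; try lra.
    + intros x; apply (cont2_app h (fun x => x) (fun _ => t)); [exact Ch | cont_tac |
        cont_tac].
    + intros x Hx; unfold h, al; rewrite clamp_id by lra.
      replace (sg * bump p1 q1 x * be t * A x t)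
        with (bump p1 q1 x * be t * (sg * A x t)) by ring.
      apply Rmult_lt_0_compat; [apply Rmult_lt_0_compat; apply bump_pos; assumption|].
      apply Apos; apply Rabs_def1; lra.
    + intros x Hx; unfold h; rewrite (Zal x Hx); ring.
  - intros t Ht; apply RInt_eq_zero; [lra|]; intros x _.
    unfold h, be; rewrite bump_zero by exact Ht; ring. }
rewrite (double_RInt_ext _ h) in E; [lra | lra |].
intros x t Ht; rewrite EA by exact Ht; unfold h; rewrite clamp_id by exact Ht.
f_equal; apply is_derive_unique.
eapply is_derive_eq.
- apply @is_derive_plus; [apply @is_derive_const|].
  apply is_derive_Rscal_r, @is_derive_id.
- unfold plus, zero, one; simpl; ring.
Qed.

(** * Burgers' equation *)

Section Limits.
Context {T : Type} {FF : (T -> Prop) -> Prop} {HFF : Filter FF}.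

Lemma filterlim_Rmult (u v : T -> R) (k l : R) :
  filterlim u FF (locally k) -> filterlim v FF (locally l) ->
  filterlim (fun r => u r * v r) FF (locally (k * l)).
Proof.
intros Hu Hv; exact (filterlim_comp_2 _ _ _ Hu Hv (@filterlim_mult R_AbsRing k l)).
Qed.

Lemma filterlim_Rplus (u v : T -> R) (k l : R) :
  filterlim u FF (locally k) -> filterlim v FF (locally l) ->
  filterlim (fun r => u r + v r) FF (locally (k + l)).
Proof.
intros Hu Hv; exact (filterlim_comp_2 _ _ _ Hu Hv (@filterlim_plus R_AbsRing
  R_NormedModule k l)).
Qed.

Lemma filterlim_Rinv (u : T -> R) (k : R) : k <> 0 ->
  filterlim u FF (locally k) -> filterlim (fun r => / u r) FF (locally (/ k)).
Proof.
intros Hk Hu; apply (filterlim_comp _ _ _ u Rinv _ _ _ Hu).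
apply (@ex_derive_continuous R_AbsRing R_NormedModule Rinv k).
auto_derive; exact Hk.
Qed.

End Limits.

(** Hadamard's factorization of [F y r - F y0 r] by [y - y0]; it turns chain
    rules along curves that are merely known to converge into limits of
    products. *)
Definition slope (F : R -> R -> R) (y0 y r : R) : R :=
  if Req_dec_T y y0 then dx F y0 r else (F y r - F y0 r) / (y - y0).

Lemma slope_spec F y0 y r : F y r - F y0 r = slope F y0 y r * (y - y0).
Proof.
unfold slope; destruct (Req_dec_T y y0) as [->|H]; [ring | field; lra].
Qed.

(** By the mean value theorem the slope is a value of [F_x] at a nearby point. *)
Lemma filterlim_slope {T : Type} (FF : (T -> Prop) -> Prop) {HFF : Filter FF}
    (U : R * R -> Prop) (F : R -> R -> R) (y0 t0 : R) (Y r : T -> R) :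
  open U -> smooth2 U F -> U (y0, t0) ->
  filterlim Y FF (locally y0) -> filterlim r FF (locally t0) ->
  filterlim (fun z => slope F y0 (Y z) (r z)) FF (locally (dx F y0 t0)).
Proof.
intros HO HF HU HY Hr; apply filterlim_locally; intros eps.
destruct (HO _ HU) as [d1 Hd1].
destruct (proj1 (filterlim_locally _ _) (smooth2_cont U _ _ _ (smooth2_dx U F HF) HU)
  eps)
  as [d2 Hd2].
set (d := mkposreal _ (Rmin_stable_in_posreal d1 d2)).
assert (L1 : d <= d1) by apply Rmin_l.
assert (L2 : d <= d2) by apply Rmin_r.
generalize (filter_and _ _ (proj1 (filterlim_locally Y y0) HY d)
                           (proj1 (filterlim_locally r t0) Hr d)).
apply filter_imp; intros z [By Br].
change (Rabs (Y z - y0) < d) in By; change (Rabs (r z - t0) < d) in Br.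
assert (Hc : forall c, Rabs (c - y0) < d -> ball (dx F y0 t0) eps (dx F c (r z))).
{ intros c Bc; apply (Hd2 (c, r z)); split;
    [change (Rabs (c - y0) < d2) | change (Rabs (r z - t0) < d2)]; lra. }
unfold slope; destruct (Req_dec_T (Y z) y0) as [Ey|Ey].
- apply Hc; rewrite Rminus_diag, Rabs_R0; apply cond_pos.
- assert (Hbt : forall c, Rmin y0 (Y z) <= c <= Rmax y0 (Y z) -> Rabs (c - y0) < d).
  { intros c Hcc; apply Rle_lt_trans with (2 := By); revert Hcc.
    unfold Rmin, Rmax, Rabs; destruct Rle_dec; repeat destruct Rcase_abs; lra. }
  assert (HD : forall c, Rmin y0 (Y z) <= c <= Rmax y0 (Y z) ->
    is_derive (fun y => F y (r z)) c (dx F c (r z))).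
  { intros c Hcc; apply Derive_correct, smooth2_ex_dx with U; [exact HF|].
    apply Hd1; split; [change (Rabs (c - y0) < d1) | change (Rabs (r z - t0) < d1)];
      generalize (Hbt c Hcc); lra. }
  destruct (MVT_gen (fun y => F y (r z)) y0 (Y z) (fun c => dx F c (r z)))
    as [c [Hcc Ec]].
  + intros c Hcc; apply HD; lra.
  + intros c Hcc; apply continuity_pt_filterlim,
      (@ex_derive_continuous R_AbsRing R_NormedModule (fun y => F y (r z)) c).
    eexists; apply HD, Hcc.
  + replace ((F (Y z) (r z) - F y0 (r z)) / (Y z - y0)) with (dx F c (r z)).
    * apply Hc, Hbt, Hcc.
    * rewrite Ec; field; lra.
Qed.

(** With [Y] the inverse of [f] in the space variable, the slope of [F] relates
    the increments of [Y] to those of [x] or of [F(y0,.)], which yields [Y_x] and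
    [Y_t]; the slope of [F_t] then gives the derivatives of [u = F_t(Y,t)]. *)
Lemma burgers_of_geodesic_equation (a b : R) (f : R -> R -> R) :
  a < b -> smooth_curve a b f -> geodesic_equation a b f ->
  burgers_on a b (fun x t => exists y, f y t = x) (eulerian_velocity a b f).
Proof.
intros Hab [Hs [Hemb _]] Hgeo x0 t0 Ht0 [y0 Hy0].
destruct (curve_extension a b f Hab Hs) as [U [F [HO [HF HE]]]].
pose proof (smooth2_dy U F HF) as HG.
destruct (HE y0 t0 Ht0) as [HU [Ff [Efx [Eft [Eftt Eftx]]]]].
assert (Fpos : 0 < dx F y0 t0) by (rewrite <- Efx; apply (Hemb t0 Ht0)).
assert (Hf1 : forall t, Icc a b t -> smooth1 (fun y => f y t))
  by (intros t Ht; exact (proj1 (proj1 (Hemb t Ht)))).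
assert (Hfp : forall t, Icc a b t -> forall y, 0 < Derive (fun y => f y t) y)
  by (intros t Ht; apply (proj2 (Hemb t Ht))).
assert (Hinc : forall d, 0 < d -> f (y0 - d) t0 < x0 < f (y0 + d) t0).
{ intros d Hd; rewrite <- Hy0; split;
    apply (increasing_of_Derive_pos (fun y => f y t0)); auto; lra. }
assert (Hinj : forall u v, f u t0 = f v t0 -> u = v) by apply (Hemb t0 Ht0).
assert (Eu : forall x t, Icc a b t ->
  eulerian_velocity a b f x t = dy F (inverse (fun y => f y t) x) t).
{ intros x t Ht; unfold eulerian_velocity.
  apply (HE (inverse (fun y => f y t) x) t Ht). }
assert (EY0 : inverse (fun y => f y t0) x0 = y0) by (apply inverse_eq; assumption).
assert (Du : is_derive (fun x => eulerian_velocity a b f x t0) x0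
               (/ dx F y0 t0 * dx (dy F) y0 t0)).
{ set (Y := inverse (fun y => f y t0)).
  assert (HY : forall d, 0 < d ->
    locally' x0 (fun x => f (Y x) t0 = x /\ Rabs (Y x - y0) < d)).
  { intros d Hd; destruct (Hinc d Hd) as [H1 H2].
    exists (mkposreal (Rmin (x0 - f (y0 - d) t0) (f (y0 + d) t0 - x0))
      ltac:(apply Rmin_glb_lt; lra)).
    intros x Hx _; change (Rabs (x - x0) < Rmin (x0 - f (y0 - d) t0) (f (y0 + d)
      t0 - x0)) in Hx.
    assert (Hl := Rmin_l (x0 - f (y0 - d) t0) (f (y0 + d) t0 - x0)).
    assert (Hr := Rmin_r (x0 - f (y0 - d) t0) (f (y0 + d) t0 - x0)).
    apply Rabs_def2 in Hx.
    apply (inverse_near (fun y => f y t0)); auto; lra. }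
  assert (LY : filterlim Y (locally' x0) (locally y0)).
  { apply filterlim_locally; intros eps.
    apply filter_imp with (2 := HY eps (cond_pos eps)); intros x [_ Hx]; exact Hx. }
  assert (LS := filterlim_slope (locally' x0) U F y0 t0 Y (fun _ => t0) HO HF HU LY
    (filterlim_const t0)).
  apply is_derive_ext with (fun x => dy F (Y x) t0).
  { intros x; symmetry; apply Eu, Ht0. }
  apply (is_derive_comp (fun y => dy F y t0) Y).
  - unfold Y; rewrite EY0; apply Derive_correct, smooth2_ex_dx with U; assumption.
  - apply quotient_is_derive.
    apply filterlim_ext_loc with (fun x => / slope F y0 (Y x) t0).
    2:{ apply filterlim_Rinv; [lra | exact LS]. }
    destruct (HY 1 Rlt_0_1) as [d0 Hd0].
    exists d0; intros x Bx Hne; destruct (Hd0 x Bx Hne) as [Ex _].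
    assert (Sp := slope_spec F y0 (Y x) t0).
    destruct (HE (Y x) t0 Ht0) as [_ [EF _]]; rewrite EF, Ex, Ff, Hy0 in Sp.
    replace (Y x0) with y0 by (symmetry; exact EY0).
    assert (HYne : Y x - y0 <> 0) by (intros E0; rewrite E0, Rmult_0_r in Sp; lra).
    assert (HSne : slope F y0 (Y x) t0 <> 0) by (intros E0; rewrite E0,
      Rmult_0_l in Sp; lra).
    rewrite Sp; field; split; assumption. }
assert (Dt : is_derive_in (Icc a b) (fun t => eulerian_velocity a b f x0 t) t0
  (dx (dy F) y0 t0 * (- dy F y0 t0 * / dx F y0 t0) + dy (dy F) y0 t0)).
{ set (Y := fun t => inverse (fun y => f y t) x0).
  set (FF := within (Icc a b) (locally' t0)).
  assert (PF : ProperFilter FF) by (apply Icc_proper; assumption).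
  assert (toFF : forall P : R -> Prop, locally t0 P -> FF P).
  { intros P HP; apply filter_imp with (2 := HP); auto. }
  assert (HY : forall d, 0 < d ->
    FF (fun t => f (Y t) t = x0 /\ Rabs (Y t - y0) < d)).
  { intros d Hd; destruct (Hinc d Hd) as [H1 H2].
    assert (CF : forall y, continuous (fun t => F y t) t0).
    { intros y; apply (@ex_derive_continuous R_AbsRing R_NormedModule (F y)).
      apply smooth2_ex_dy with U; [exact HF | apply (HE y t0 Ht0)]. }
    destruct (HE (y0 - d) t0 Ht0) as [_ [E1 _]]; rewrite <- E1 in H1.
    destruct (HE (y0 + d) t0 Ht0) as [_ [E2 _]]; rewrite <- E2 in H2.
    assert (N1 : FF (fun t => F (y0 - d) t < x0))
      by (apply toFF, (CF (y0 - d) (fun v => v < x0)), open_lt, H1).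
    assert (N2 : FF (fun t => x0 < F (y0 + d) t))
      by (apply toFF, (CF (y0 + d) (fun v => x0 < v)), open_gt, H2).
    generalize (filter_and _ _ N1 N2); unfold FF, locally', within.
    apply filter_imp; intros t H Hne Ht; specialize (H Hne Ht).
    apply (inverse_near (fun y => f y t)); auto.
    destruct (HE (y0 - d) t Ht) as [_ [<- _]];
    destruct (HE (y0 + d) t Ht) as [_ [<- _]]; auto. }
  assert (LY : filterlim Y FF (locally y0)).
  { apply filterlim_locally; intros eps.
    apply filter_imp with (2 := HY eps (cond_pos eps)); intros x [_ Hx]; exact Hx. }
  assert (Lid : filterlim (fun t => t) FF (locally t0)) by (intros P HP; apply toFF,
    HP).
  assert (LS := filterlim_slope FF U F y0 t0 Y (fun t => t) HO HF HU LY Lid).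
  assert (LSG := filterlim_slope FF U (dy F) y0 t0 Y (fun t => t) HO HG HU LY Lid).
  assert (toQ : forall g l, is_derive g t0 l ->
    filterlim (fun s => (g s - g t0) / (s - t0)) FF (locally l)).
  { intros g l Hg; apply (is_derive_in_of_is_derive a b g g t0 l); auto. }
  assert (LQ := toQ _ _ (Derive_correct _ _ (smooth2_ex_dy U F y0 t0 HF HU))).
  assert (LQG := toQ _ _ (Derive_correct _ _ (smooth2_ex_dy U (dy F) y0 t0 HG HU))).
  (* f(Y(t),t) is constant, so slope F * (Y - y0) = -(F(y0,.) - F(y0,t0)) *)
  unfold is_derive_in; fold FF.
  eapply filterlim_ext_loc.
  2:{ apply filterlim_Rplus; [|exact LQG].
      apply filterlim_Rmult; [exact LSG|].
      apply filterlim_Rmult; [|apply filterlim_Rinv; [lra | exact LS]].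
      replace (- dy F y0 t0) with (-1 * dy F y0 t0) by ring.
      apply filterlim_Rmult; [apply filterlim_const | exact LQ]. }
  assert (NS : FF (fun t => 0 < slope F y0 (Y t) t)) by (apply LS, open_gt, Fpos).
  generalize (filter_and _ _ NS (HY 1 Rlt_0_1)); unfold FF, locally', within.
  apply filter_imp; intros t H Hne Ht.
  destruct (H Hne Ht) as [Spos [Ex _]].
  rewrite !Eu by assumption.
  fold (Y t); rewrite EY0.
  assert (Sp := slope_spec F y0 (Y t) t).
  assert (SpG := slope_spec (dy F) y0 (Y t) t).
  destruct (HE (Y t) t Ht) as [_ [EF _]]; rewrite EF, Ex in Sp.
  rewrite Ff, Hy0.
  replace (dy F (Y t) t) with (slope (dy F) y0 (Y t) t * (Y t - y0) + dy F y0 t)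
    by lra.
  replace (F y0 t - x0) with (- (slope F y0 (Y t) t * (Y t - y0))) by lra.
  field; split; [lra|].
  intros E0; apply Hne; lra. }
split; [eexists; exact Du|].
split; [eexists; exact Dt|].
rewrite (is_derive_in_unique a b _ _ _ Hab Ht0 Dt
  : dt a b (eulerian_velocity a b f) x0 t0 = _).
rewrite (is_derive_unique _ _ _ Du : dx (eulerian_velocity a b f) x0 t0 = _).
rewrite Eu, EY0 by assumption.
assert (E := Hgeo y0 t0 Ht0); rewrite Eftt, Eft, Eftx, Efx in E; rewrite E.
field; lra.
Qed.

Theorem mainTheorem1 (a b : R) (Hab : a < b) (f : R -> R -> R)
    (Hf : smooth_curve a b f) :
  (critical_point (energy a b) a b f <-> geodesic a b f) /\
  (critical_point (energy a b) a b f <-> geodesic_equation a b f) /\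
  (geodesic a b f ->
     burgers_on a b (fun x t => exists y, f y t = x) (eulerian_velocity a b f)).
Proof.
assert (Heq : critical_point (energy a b) a b f <-> geodesic_equation a b f).
{ rewrite (geodesic_equation_defect a b f Hf); split.
  - apply critical_point_defect; assumption.
  - apply defect_critical_point; assumption. }
split; [|split].
- apply geodesic_critical_point, Hab.
- exact Heq.
- intros Hg; apply burgers_of_geodesic_equation; try assumption.
  apply Heq, geodesic_critical_point; assumption.
Qed.
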